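(* For any $\tau\ge 0$ and any $\alpha\in\mathbb{R}$, there is a generic subset $\mathcal{S}$ of $\mathcal{S}^I_n$ such that, for every system $\sigma^o\in\mathcal{S}$, there is some $\widehat{\sigma^o}\in\mathcal{S}$ such that (1) $\sigma^o$ and $\widehat{\sigma^o}$ are i/o equivalent under the pulse function $\mathbf{u}_{\tau,\alpha}$, but (2) $\sigma^o$ and $\widehat{\sigma^o}$ are not i/o equivalent.
   Context: A 4-tuple of dimension $n$ is $(A,N,b,c)$ with $A,N\in\mathbb{R}^{n\times n}$, $b\in\mathbb{R}^{n\times 1}$, $c\in\mathbb{R}^{1\times n}$. The bilinear system of type I associated with it is $\dot x=(A+uN)x+bu$, $x(0)=0$, $y=cx$. The class $\mathcal{S}^I_n$ of all $n$-dimensional bilinear systems of type I is identified with $\mathbb{R}^{2n^2+2n}$ via 4-tuples. A subset of $\mathbb{R}^\ell$ is called generic if it is open and dense and its complement has Lebesgue measure zero. Inputs are Lebesgue-measurable, essentially bounded functions $u:[0,T_u]\to\mathbb{R}$; $\Omega$ is the set of all inputs. Two systems are i/o equivalent under a set $\mathcal{U}\subseteq\Omega$ of inputs (or under a single input) if for each $u\in\mathcal{U}$ the two outputs $y(t)$ coincide for all $t\in[0,T_u]$; they are i/o equivalent (no qualifier) if this holds with $\mathcal{U}=\Omega$. The pulse is $\mathbf{u}_{\tau,\alpha}(t)=\alpha$ for $0\le t<\tau$ and $\mathbf{u}_{\tau,\alpha}(t)=0$ for $t\ge\tau$. Pulses may be viewed as defined on $[0,T]$ for any $T>\tau$; the choice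 of $T$ is immaterial, so equivalence under the pulse means that outputs coincide for all $t\ge 0$.
   Formalization: The dimension is assumed to satisfy n ≥ 2; for n = 0, and for n = 1 with τ > 0 and α ≠ 0, the claim is false (a one-dimensional system with cb ≠ 0 is determined up to i/o equivalence by its pulse response). *)

(* Defs.v *)
From HB Require Import structures.
From mathcomp Require Import all_boot all_order all_algebra.
From mathcomp Require Import all_classical all_reals all_analysis.

Set Implicit Arguments.
Unset Strict Implicit.
Unset Printing Implicit Defensive.

Import Order.TTheory GRing.Theory Num.Theory.
Import numFieldNormedType.Exports.

Local Open Scope classical_set_scope.
Local Open Scope ring_scope.

Record bilinear_system (R : realType) (n : nat) := BilinearSystem {
  sysA : 'M[R]_n;
  sysN : 'M[R]_n;
  sysb : 'cV[R]_n;
  sysc : 'rV[R]_n }.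

Definition system_vec (R : realType) (n : nat) (s : bilinear_system R n) :
    'rV[R]_(n * n + n * n + (n + n)) :=
  row_mx (row_mx (mxvec (sysA s)) (mxvec (sysN s))) (row_mx (sysb s)^T (sysc s)).

Definition box (R : realType) (l : nat) (a b : 'rV[R]_l) : set 'rV[R]_l :=
  [set v | forall i, a 0 i <= v 0 i <= b 0 i].

(* Lebesgue outer measure on R^l, l > 0.  It agrees with Lebesgue measure on
   measurable sets, in particular on the complement of an open set. *)
Definition lebesgue_outer (R : realType) (l : nat) (V : set 'rV[R]_l) : \bar R :=
  ereal_inf [set r | exists a b : nat -> 'rV[R]_l,
    [/\ forall k i, a k 0 i <= b k 0 i,
        V `<=` \bigcup_k box (a k) (b k) &
        r = (\sum_(0 <= k <oo) (\prod_i (b k 0 i - a k 0 i))%:E)%E]].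

Definition generic (R : realType) (l : nat) (V : set 'rV[R]_l) : Prop :=
  [/\ open V, dense V & lebesgue_outer (~` V) = 0%E].

Definition generic_systems (R : realType) (n : nat)
    (S : set (bilinear_system R n)) : Prop :=
  generic (@system_vec R n @` S).

(* R with the sigma-algebra of Lebesgue (not only Borel) measurable sets. *)
Definition lebesgueTypeR (R : realType) :=
  caratheodory_type (mu_ext (@wlength R idfun)).

Notation lebesgue := (@completed_lebesgue_measure _) (only parsing).

(* A pair (T, u) is an input of duration T.  The values of u outside [0, T]
   are irrelevant: no definition below depends on them. *)
Definition inputs (R : realType) : set (R * (R -> R)) :=
  [set p | [/\ 0 <= p.1,
    measurable_fun (`[0, p.1]%classic : set (lebesgueTypeR R))
      (p.2 : lebesgueTypeR R -> measurableTypeR R) &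
    exists M : R, \forall t \ae lebesgue,
      0 <= t <= p.1 -> `|p.2 t| <= M]].

Definition rhs (R : realType) (n : nat) (s : bilinear_system R n)
    (u : R -> R) (x : R -> 'cV[R]_n) (t : R) : 'cV[R]_n :=
  (sysA s + u t *: sysN s) *m x t + u t *: sysb s.

(* Caratheodory solutions on [0, T] of x' = (A + u N) x + b u with x(0) = 0,
   i.e. x(t) is the integral of the right-hand side over [0, t].
   They exist and are unique on [0, T] for every input (T, u). *)
Definition trajectory (R : realType) (n : nat) (s : bilinear_system R n)
    (T : R) (u : R -> R) (x : R -> 'cV[R]_n) : Prop :=
  forall i : 'I_n,
    lebesgue.-integrable `[0, T] (fun t => (rhs s u x t i 0)%:E) /\
    forall t, 0 <= t <= T ->
      x t i 0 = \int[lebesgue]_(r in `[0, t]) (rhs s u x r i 0).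

Definition output (R : realType) (n : nat) (s : bilinear_system R n)
    (x : R -> 'cV[R]_n) (t : R) : R := (sysc s *m x t) 0 0.

Definition io_equiv_under (R : realType) (n : nat) (U : set (R * (R -> R)))
    (s s' : bilinear_system R n) : Prop :=
  forall T u, U (T, u) -> forall x x',
    trajectory s T u x -> trajectory s' T u x' ->
    forall t, 0 <= t <= T -> output s x t = output s' x' t.

Definition io_equiv (R : realType) (n : nat)
    (s s' : bilinear_system R n) : Prop := io_equiv_under (@inputs R) s s'.

Definition pulse (R : realType) (tau alpha : R) (t : R) : R :=
  if 0 <= t < tau then alpha else 0.

(* The pulse on all the intervals [0, T] with T > tau, so that equivalence
   under this set means that the outputs coincide for all t >= 0. *)
Definition pulses (R : realType) (tau alpha : R) : set (R * (R -> R)) :=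
  [set p | tau < p.1 /\ p.2 = pulse tau alpha].

(* Main.v *)
Require Import Defs.
From mathcomp Require Import all_boot all_order all_algebra.
From mathcomp Require Import all_classical all_reals all_analysis.
From mathcomp Require Import measurable_realfun ring lra.
Import Order.TTheory GRing.Theory Num.Theory.
Import numFieldNormedType.Exports.
Local Open Scope classical_set_scope.
Local Open Scope ring_scope.

(** Let F = A + alpha N be the drift while the pulse is on.  Under the pulse the
state follows x' = F x + alpha b up to time tau and x' = A x afterwards, so the
output depends only on F, b, c and on the function t |-> c e^(tA) x(tau).
Suppose that alpha <> 0 and that an invertible P satisfies c P = c and
P x(tau) = x(tau).  Replace A by A' = P^-1 A P and choose N' such that
A' + alpha N' = F.  The two states agree up to time tau; afterwards x = P x',
because both sides solve the same linear equation from the same value, and so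
c x = c P x' = c x' ([pulse_trajectory_unique], [pulse_trajectory_after]).
The matrix P is a rank one perturbation 1 + v w of the identity, with c v = 0
and w x(tau) = 0, where v and w are supported on the same two coordinates
([shear_exists]).

The two systems are told apart by pulses of the same amplitude and of all other
durations.  If they were equivalent, then differentiating the outputs just
after a pulse of duration t would give c A x(t) = c A' x(t) for the common state
x(t) ([io_equiv_pulse_moment]).  Since c A' = c A + (c A v) w, the function
w x(t) would vanish as soon as c A v <> 0, and its first two derivatives at 0
would give w b = 0 and w F b = 0 ([row_annihilates]).  Both c A v <> 0 and the
impossibility of w b = w F b = 0 follow from the nonvanishing of one 2 x 2
minor of (c, c A) and one of (b, F b).  If alpha = 0, the pulse is the zero
input and every output under it vanishes; then c is replaced by - c, and c b <> 0
makes the two systems inequivalent.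

The set defined by these conditions is generic ([generic_nondegenerate]): each
condition is the nonvanishing of a polynomial that is affine in one coordinate,
with a leading coefficient that is 1 or that an earlier condition makes nonzero.  The zero
set of such a polynomial is a countable union of Lipschitz graphs, and a bounded
Lipschitz graph is covered by about K^(l-1) boxes of volume O(K^-l)
([generic_affine], [lebesgue_outer_lipschitz_graph]).

Equivalence quantifies over Caratheodory solutions.  Their uniqueness
([primitive_linear_eq0]) is what makes the pulse equivalence work, while
inequivalence needs actual solutions: these are built from power series
([linear_ode_solution]) and turned into integrals by the fundamental theorem of
calculus, transferred to the completed Lebesgue measure ([FTC2_completed]). *)

Set Implicit Arguments.
Unset Strict Implicit.
Unset Printing Implicit Defensive.

(** * Covers by boxes and null sets of R^l *)

(** Countable index types other than nat enter the definition of the outer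
measure through their encoding in nat; indices that encode nothing contribute
zero volume. *)
Lemma nneseries_pickle (R : realType) (I : countType) (v : I -> \bar R) :
  (forall i, 0 <= v i)%E ->
  (\sum_(0 <= k <oo) oapp v 0 (@pickle_inv I k) = \esum_(i in [set: I]) v i)%E.
Proof.
move=> v0.
have w0 k : (0 <= oapp v 0 (@pickle_inv I k))%E by case: pickle_inv.
rewrite nneseries_esumT//.
transitivity (\esum_(k in range (@pickle I)) oapp v 0%E (pickle_inv k))%E.
  rewrite [RHS]esum_mkcond; apply: eq_esum => k _; case: ifPn => //.
  rewrite notin_setE => /= kI; have := @pickle_invK I k.
  by case: pickle_inv => //= i ik; exfalso; apply: kI; exists i.
rewrite esum_image; last by move=> i j _ _; exact: (pcan_inj pickleK_inv).
by apply: eq_esum => i _; rewrite pickleK_inv.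
Qed.

Lemma lebesgue_outer_ge0 (R : realType) (l : nat) (V : set 'rV[R]_l) :
  (0 <= lebesgue_outer V)%E.
Proof.
apply: le_ereal_inf_tmp => _ [a [b [ab _ ->]]].
by apply: nneseries_ge0 => k _ _; rewrite lee_fin prodr_ge0// => i _; rewrite subr_ge0.
Qed.

(** The hypothesis l > 0 is what gives the box {0} volume zero: for l = 0 the
empty product of side lengths is 1. *)
Lemma lebesgue_outer_eq0 (R : realType) (l : nat) (V : set 'rV[R]_l) :
  (0 < l)%N ->
  (forall e : R, 0 < e -> exists (I : countType) (a b : I -> 'rV[R]_l),
    [/\ forall k i, a k 0 i <= b k 0 i,
        V `<=` \bigcup_k box (a k) (b k) &
        (\esum_(k in [set: I]) (\prod_i (b k 0 i - a k 0 i))%:E <= e%:E)%E]) ->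
  lebesgue_outer V = 0%E.
Proof.
move=> l0 Vcov; apply/eqP; rewrite eq_le lebesgue_outer_ge0 andbT.
apply/lee_addgt0Pr => e e0; rewrite add0e.
have [I [a [b [ab Vab abe]]]] := Vcov e e0.
apply: le_trans abe; apply: ereal_inf_lbound.
exists (fun k => oapp a 0 (@pickle_inv I k)), (fun k => oapp b 0 (@pickle_inv I k)).
split.
- by move=> k i; case: pickle_inv => [j|]//=.
- by move=> x /Vab[j _ xj]; exists (pickle j) => //; rewrite pickleK_inv.
- rewrite -nneseries_pickle; last first.
    by move=> j; rewrite lee_fin prodr_ge0// => i _; rewrite subr_ge0.
  apply: eq_eseriesr => k _; case: pickle_inv => [j|]//=.
  (* indices that encode nothing carry the degenerate box {0} *)
  by rewrite (bigD1 (Ordinal l0))//= subrr mul0r.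
Qed.

Lemma lebesgue_outer_set0 (R : realType) (l : nat) :
  (0 < l)%N -> lebesgue_outer (@set0 'rV[R]_l) = 0%E.
Proof.
move=> l0; apply: lebesgue_outer_eq0 => // e e0.
exists void, (fun=> 0), (fun=> 0); split=> //.
by rewrite esum1 ?lee_fin ?ltW// => -[].
Qed.

Lemma lebesgue_outer_eq0_cover (R : realType) (l : nat) (V : set 'rV[R]_l) (e : R) :
  lebesgue_outer V = 0%E -> 0 < e ->
  exists a b : nat -> 'rV[R]_l,
    [/\ forall k i, a k 0 i <= b k 0 i,
        V `<=` \bigcup_k box (a k) (b k) &
        (\esum_(k in [set: nat]) (\prod_i (b k 0 i - a k 0 i))%:E <= e%:E)%E].
Proof.
move=> V0 e0; have : (lebesgue_outer V < e%:E)%E by rewrite V0 lte_fin.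
move=> /ereal_inf_lt[_ [a [b [ab Vab ->]]] abe].
exists a, b; split => //; rewrite -nneseries_esumT; first exact: ltW.
by move=> j; rewrite lee_fin prodr_ge0// => i _; rewrite subr_ge0.
Qed.

Lemma lebesgue_outer_bigcup (R : realType) (l : nat) (V : nat -> set 'rV[R]_l) :
  (0 < l)%N -> (forall m, lebesgue_outer (V m) = 0%E) ->
  lebesgue_outer (\bigcup_m V m) = 0%E.
Proof.
move=> l0 V0; apply: lebesgue_outer_eq0 => // e e0.
have /choice[ab abP] m : exists p : (nat -> 'rV[R]_l) * (nat -> 'rV[R]_l),
    (* the m-th set gets a cover of volume e / 2^(m+1) *)
    [/\ forall k i, p.1 k 0 i <= p.2 k 0 i,
        V m `<=` \bigcup_k box (p.1 k) (p.2 k) &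
        (\esum_(k in [set: nat]) (\prod_i (p.2 k 0 i - p.1 k 0 i))%:E
          <= (e / (2 ^ m.+1)%:R)%:E)%E].
  have /(lebesgue_outer_eq0_cover (V0 m))[a [b abV]] : 0 < e / (2 ^ m.+1)%:R.
    by rewrite divr_gt0// ltr0n expn_gt0.
  by exists (a, b).
exists (nat * nat)%type, (fun k => (ab k.1).1 k.2), (fun k => (ab k.1).2 k.2); split.
- by move=> [m k] i /=; case: (abP m).
- move=> x [m _ Vx]; have [_ /(_ _ Vx)[k _ xk] _] := abP m.
  by exists (m, k).
- have := @esum_esum R nat nat setT (fun=> setT)
    (fun m k => (\prod_i ((ab m).2 k 0 i - (ab m).1 k 0 i))%:E).
  rewrite (_ : setT `*`` _ = setT); last by apply/seteqP; split.
  move=> <-; last first.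
    move=> m k _ _; rewrite lee_fin prodr_ge0// => i _.
    by rewrite subr_ge0; case: (abP m).
  apply: (@le_trans _ _ (\esum_(m in [set: nat]) (e / (2 ^ m.+1)%:R)%:E)%E).
    by apply: le_esum => m _; case: (abP m).
  rewrite -nneseries_esumT; last by move=> m; rewrite lee_fin divr_ge0 ?ltW.
  by have := @epsilon_trick0 R e xpredT (ltW e0).
Qed.

Lemma sub_lebesgue_outer_eq0 (R : realType) (l : nat) (V W : set 'rV[R]_l) :
  V `<=` W -> lebesgue_outer W = 0%E -> lebesgue_outer V = 0%E.
Proof.
move=> VW W0; apply/eqP; rewrite eq_le lebesgue_outer_ge0 andbT -W0.
apply: le_ereal_inf_tmp => r [a [b [ab Wab ->]]].
by apply: ereal_inf_lbound; exists a, b; split => //; exact: subset_trans Wab.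
Qed.

(** * Lipschitz graphs are null *)

Lemma esum_finType (R : realType) (I : finType) (v : I -> R) :
  (forall i, 0 <= v i) -> (\esum_(i in [set: I]) (v i)%:E = (\sum_i v i)%:E)%E.
Proof.
move=> v0; rewrite esum_fset//; first last.
- by move=> i _; rewrite lee_fin.
- exact: finite_finset.
rewrite (fsbigE (index_enum I)) ?index_enum_uniq//=; last first.
- by move=> i _; rewrite mem_index_enum.
- rewrite sumEFin; congr (_%:E); apply: eq_bigl => i; exact: in_setT.
Qed.

(** The last cell must be treated apart: at t = M the truncation gives the index
K.+1, one past the last cell. *)
Lemma grid_cell (R : realType) (M t : R) (K : nat) :
  `|t| <= M -> exists k : 'I_K.+1,
    - M + k%:R * (2 * M / K.+1%:R) <= t <= - M + k.+1%:R * (2 * M / K.+1%:R).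
Proof.
move=> tM; have M0 : 0 <= M by exact: le_trans tM.
move: tM; rewrite ler_norml => /andP[tM1 tM2].
set h := 2 * M / K.+1%:R.
have hK : K.+1%:R * h = 2 * M by rewrite /h mulrCA divff ?mulr1.
have [M00|Mn0] := eqVneq M 0.
  exists ord0; have h0 : h = 0 by rewrite /h M00 mulr0 mul0r.
  by rewrite h0 !mulr0 M00 !(oppr0, addr0, lexx)// -[leLHS]oppr0 -M00 tM1 tM2.
have Mp : 0 < M by rewrite lt_neqAle eq_sym Mn0.
have h0 : 0 < h by rewrite /h divr_gt0// mulr_gt0.
clearbody h.
have [tM|tM] := eqVneq t M.
  exists ord_max => /=; rewrite hK tM; apply/andP; split; last lra.
  by have : K%:R * h <= K.+1%:R * h by [rewrite ler_pM2r// ler_nat]; rewrite hK => ?; lra.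
have tM3 : t < M by rewrite lt_neqAle tM.
have d0 : 0 <= (t + M) / h by rewrite divr_ge0 ?(ltW h0)//; lra.
have dK : (Num.trunc ((t + M) / h) < K.+1)%N.
  by rewrite truncn_lt_nat// ltr_pdivrMr// hK; lra.
exists (Ordinal dK) => /=.
have /andP[] := truncn_itv d0; rewrite ler_pdivlMr// ltr_pdivrMr//.
by move=> ? ?; apply/andP; split; lra.
Qed.

(** Cut the l - 1 other coordinates into K.+1 intervals of length h = 2 M / K.+1.
Above each of the K.+1 ^ (l-1) cells, the set has extent at most 2 C h in
coordinate i, so that the total volume is 2 C h (2 M)^(l-1) = O(1 / K). *)
Lemma lebesgue_outer_lipschitz_graph (R : realType) (l : nat) (Z : set 'rV[R]_l)
    (i : 'I_l) (M C : R) : 0 <= C ->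
  (forall x, Z x -> forall j, `|x 0 j| <= M) ->
  (forall d y z, 0 <= d -> Z y -> Z z ->
    (forall j, j != i -> `|y 0 j - z 0 j| <= d) -> `|y 0 i - z 0 i| <= C * d) ->
  lebesgue_outer Z = 0%E.
Proof.
move=> C0 ZM ZC; have l0 : (0 < l)%N by case: l i {Z ZM ZC} => [[]|].
have [->|/set0P[x0 Zx0]] := eqVneq Z set0.
  exact: lebesgue_outer_set0.
have M0 : 0 <= M by apply: le_trans (ZM _ Zx0 i).
apply: lebesgue_outer_eq0 => // e e0.
pose A := 2 * C * (2 * M) ^+ l.
have A0 : 0 <= A by rewrite mulr_ge0 ?exprn_ge0// mulr_ge0.
pose K := Num.trunc (A / e).
pose h := 2 * M / K.+1%:R.
have h0 : 0 <= h by rewrite /h divr_ge0// mulr_ge0.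
have hK : K.+1%:R * h = 2 * M by rewrite /h mulrCA divff ?mulr1.
have AK : A <= e * K.+1%:R.
  by rewrite mulrC -ler_pdivrMr// ltW// truncnS_gt.
have cellP t : `|t| <= M ->
    exists k : 'I_K.+1, - M + k%:R * h <= t <= - M + k.+1%:R * h.
  exact: grid_cell.
clearbody h.
pose lo (k : 'I_K.+1) : R := - M + k%:R * h.
pose hi (k : 'I_K.+1) : R := - M + k.+1%:R * h.
have lohi k : hi k - lo k = h by rewrite /hi /lo -natr1; ring.
(* All K.+1 ^ l grid functions index the boxes, but those with f i <> 0 get a
   box of width 0 in coordinate i; this makes the total volume a product of
   sums. *)
pose I := {ffun 'I_l -> 'I_K.+1}.
pose cell (f : I) : set 'rV[R]_l :=
  [set x | Z x /\ forall j, j != i -> lo (f j) <= x 0 j <= hi (f j)].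
have /choice[p pP] (f : I) : exists p, cell f !=set0 -> cell f p.
  by have [[p]|?] := pselect (cell f !=set0); [exists p|exists 0].
pose a (f : I) : 'rV[R]_l := \row_j if j != i then lo (f j) else
  if f i == ord0 then p f 0 i - C * h else 0.
pose b (f : I) : 'rV[R]_l := \row_j if j != i then hi (f j) else
  if f i == ord0 then p f 0 i + C * h else 0.
pose w (j : 'I_l) (k : 'I_K.+1) : R := if j != i then h else
  if k == ord0 then 2 * C * h else 0.
have w0 j k : 0 <= w j k by rewrite /w; case: ifP => // _; case: ifP => // _; rewrite !mulr_ge0.
have abw f j : b f 0 j - a f 0 j = w j (f j).
  rewrite !mxE /w; case: eqVneq => [->|] //=; case: ifP => _; by [ring|rewrite subr0].
exists I, a, b; split.
- by move=> f j; rewrite -subr_ge0 abw.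
- move=> x Zx.
  have /choice[g gP] j : exists k : 'I_K.+1, lo k <= x 0 j <= hi k.
    by apply: cellP; exact: ZM.
  pose f : I := [ffun j => if j == i then ord0 else g j].
  have cx : cell f x by split => // j /negPf ji; rewrite ffunE ji.
  have [Zp cp] := pP f (ex_intro _ x cx).
  exists f => // j; rewrite !mxE; have [->|ji] /= := eqVneq j i; last first.
    by rewrite ffunE (negPf ji).
  rewrite ffunE eqxx eqxx -ler_distlC; apply: ZC => // {}j ji.
  have /andP[? ?] := cp j ji; have /andP[? ?] := cx.2 j ji.
  have := lohi (f j) => ?; rewrite ler_norml; apply/andP; split; lra.
- under eq_esum => f _ do rewrite (eq_bigr _ (fun j _ => abw f j)).
  rewrite esum_finType; last by move=> f; exact: prodr_ge0.
  rewrite -bigA_distr_bigA/= lee_fin.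
  rewrite (bigD1 i)//= [X in _ * X](eq_bigr (fun=> 2 * M)); last first.
    move=> j ji; rewrite /w; under eq_bigr do rewrite ji.
    by rewrite sumr_const card_ord -[h *+ _]mulr_natl hK.
  rewrite (bigD1 ord0)//= big1 ?addr0; last first.
    by move=> k k0; rewrite /w eqxx/= (negPf k0).
  rewrite /w !eqxx/= prodr_const cardC1 card_ord.
  have : A = K.+1%:R * (2 * C * h * (2 * M) ^+ l.-1).
    by rewrite /A -[in LHS](prednK l0) exprS -{1}hK; ring.
  by move=> AE; move: AK; rewrite AE mulrC ler_pM2r.
Qed.

(** * Nonvanishing loci of polynomials affine in one coordinate *)

(** Lipschitz in the sup norm and bounded, with the same constant, on every cube;
the bound is what makes this class stable under products, hence contain all
polynomials. *)
Definition loc_lipschitz (R : realType) (l : nat) (f : 'rV[R]_l -> R) :=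
  forall M : R, exists2 L : R, 0 <= L &
    forall y z : 'rV[R]_l,
      (forall i, `|y 0 i| <= M) -> (forall i, `|z 0 i| <= M) ->
      `|f y| <= L /\
      forall d, 0 <= d -> (forall i, `|y 0 i - z 0 i| <= d) -> `|f y - f z| <= L * d.

Section loc_lipschitz_closure.
Variables (R : realType) (l : nat).
Implicit Types f g : 'rV[R]_l -> R.

Lemma loc_lipschitz_cst (a : R) : loc_lipschitz (fun _ : 'rV[R]_l => a).
Proof.
move=> M; exists `|a| => // y z yM zM; split=> // d d0 _.
by rewrite subrr normr0 mulr_ge0.
Qed.

Lemma loc_lipschitz_coord i : loc_lipschitz (fun x : 'rV[R]_l => x 0 i).
Proof.
move=> M; exists (Num.max M 1); first by rewrite le_max ler01 orbT.
move=> y z yM zM; split; first by rewrite le_max yM.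
move=> d d0 dP.
by apply: le_trans (dP i) _; rewrite ler_peMl// le_max lexx orbT.
Qed.

Lemma loc_lipschitzD f g :
  loc_lipschitz f -> loc_lipschitz g -> loc_lipschitz (fun x => f x + g x).
Proof.
move=> fl gl M; have [L1 L10 fL] := fl M; have [L2 L20 gL] := gl M.
exists (L1 + L2); first exact: addr_ge0.
move=> y z yM zM; have [f1 f2] := fL _ _ yM zM; have [g1 g2] := gL _ _ yM zM.
split; first by rewrite (le_trans (ler_normD _ _))// lerD.
move=> d d0 dP; rewrite opprD addrACA mulrDl (le_trans (ler_normD _ _))// lerD//.
  exact: f2.
exact: g2.
Qed.

Lemma loc_lipschitzM f g :
  loc_lipschitz f -> loc_lipschitz g -> loc_lipschitz (fun x => f x * g x).
Proof.
move=> fl gl M; have [L1 L10 fL] := fl M; have [L2 L20 gL] := gl M.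
exists (2 * (L1 * L2)); first by rewrite !mulr_ge0.
move=> y z yM zM; have [f1 f2] := fL _ _ yM zM; have [g1 g2] := gL _ _ yM zM.
have [g3 _] := gL _ _ zM yM.
split.
  rewrite normrM; apply: (@le_trans _ _ (L1 * L2)); first exact: ler_pM.
  by rewrite ler_peMl ?mulr_ge0// ler1n.
move=> d d0 dP.
have -> : f y * g y - f z * g z = f y * (g y - g z) + g z * (f y - f z) by ring.
rewrite (le_trans (ler_normD _ _))// !normrM.
have -> : 2 * (L1 * L2) * d = L1 * (L2 * d) + L2 * (L1 * d) by ring.
by rewrite lerD// ler_pM// ?f2 ?g2.
Qed.

Lemma loc_lipschitzN f : loc_lipschitz f -> loc_lipschitz (fun x => - f x).
Proof.
move=> fl M; have [L L0 fL] := fl M; exists L => // y z yM zM.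
have [f1 f2] := fL _ _ yM zM; rewrite normrN; split=> // d d0 dP.
by rewrite -opprD normrN; exact: f2.
Qed.

Lemma loc_lipschitz_sum (I : finType) (P : pred I) (F : I -> 'rV[R]_l -> R) :
  (forall k, loc_lipschitz (F k)) -> loc_lipschitz (fun x => \sum_(k | P k) F k x).
Proof.
move=> FL; rewrite unlock /=; elim: index_enum => [|k r IH] /=.
  exact: loc_lipschitz_cst.
by case: (P k) => //; exact: loc_lipschitzD.
Qed.

End loc_lipschitz_closure.

Lemma open_rVP (R : realType) (l : nat) (V : set 'rV[R]_l) :
  open V <-> forall x, V x ->
    exists2 e : R, 0 < e & forall y : 'rV[R]_l, (forall i, `|x 0 i - y 0 i| < e) -> V y.
Proof.
rewrite openE; split=> [oV x /oV /nbhs_ballP[e e0 xeV]|VP x /VP[e e0 xeV]].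
  exists e => // y xy; apply: xeV; split=> // i j.
  by rewrite ord1 -ball_normE; exact: xy.
apply/nbhs_ballP; exists e => // y [_ xy]; apply: xeV => i.
by have := xy ord0 i; rewrite -ball_normE.
Qed.

Lemma open_neq0 (R : realType) (l : nat) (p : 'rV[R]_l -> R) :
  loc_lipschitz p -> open [set x | p x != 0].
Proof.
move=> pl; apply/open_rVP => x /= px0.
pose M := 1 + \sum_i `|x 0 i|.
have xS i : `|x 0 i| <= \sum_i `|x 0 i|.
  by rewrite (bigD1 i)//= lerDl sumr_ge0.
have [L L0 pL] := pl M.
have px : 0 < `|p x| by rewrite normr_gt0.
have L1 : 0 < L + 1 by rewrite ltr_wpDl.
exists (Num.min 1 (`|p x| / (L + 1))); first by rewrite lt_min ltr01 divr_gt0.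
move=> y xy.
have xM i : `|x 0 i| <= M by rewrite (le_trans (xS i))// lerDr.
have yM i : `|y 0 i| <= M.
  have -> : y 0 i = (y 0 i - x 0 i) + x 0 i by rewrite subrK.
  rewrite (le_trans (ler_normD _ _))// lerD//.
  by have := xy i; rewrite distrC lt_min => /andP[/ltW].
have [_ /(_ (`|p x| / (L + 1)))] := pL _ _ xM yM.
rewrite divr_ge0//; last exact: ltW.
move=> /(_ isT) H.
have {}H : `|p x - p y| <= L * (`|p x| / (L + 1)).
  by apply: H => i; have := xy i; rewrite lt_min => /andP[_ /ltW].
apply: contraTneq H => ->; rewrite subr0 -ltNge mulrA ltr_pdivrMr// mulrC.
by rewrite ltr_pM2l// ltrDl.
Qed.

Lemma genericT (R : realType) (l : nat) : (0 < l)%N -> generic [set: 'rV[R]_l].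
Proof.
move=> l0; split; first exact: openT.
  by move=> O [x Ox] _; exists x.
by rewrite setCT; exact: lebesgue_outer_set0.
Qed.

(** The hypothesis on p and q says that p is affine in coordinate i with
coefficient q.  Where q <> 0, a small move along coordinate i leaves the zero
set of p, hence density.  On the bounded piece where |q| >= 1/m, two zeros y, z of p
satisfy |q z| |y_i - z_i| = |p z' - p y|, where z' is z with its coordinate i
replaced by y_i; hence that piece is a Lipschitz graph over the other
coordinates. *)
Lemma generic_affine (R : realType) (l : nat) (V : set 'rV[R]_l) (i : 'I_l)
    (p q : 'rV[R]_l -> R) :
  generic V -> loc_lipschitz p ->
  (forall x y : 'rV[R]_l, (forall j, j != i -> x 0 j = y 0 j) ->
    p y - p x = q x * (y 0 i - x 0 i)) ->
  (forall x, V x -> q x != 0) ->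
  generic [set x | V x /\ p x != 0].
Proof.
move=> [oV dV nV] pl pq q0.
have l0 : (0 < l)%N by case: l i {V p q oV dV nV pl pq q0} => [[]|].
have oV' : open [set x | V x /\ p x != 0].
  by apply: openI => //; exact: open_neq0.
split => //.
  move=> O O0 oO; have [x [Ox Vx]] := dV O O0 oO.
  have [px0|px0] := eqVneq (p x) 0; last by exists x.
  have /open_rVP/(_ x)[//|e e0 xe] : open (O `&` V) by exact: openI.
  pose y := x + (e / 2) *: delta_mx 0 i : 'rV[R]_l.
  have yx j : y 0 j - x 0 j = (e / 2) * (j == i)%:R.
    by rewrite !mxE eqxx/= addrAC subrr add0r.
  have [Oy Vy] : (O `&` V) y.
    apply: xe => j; rewrite distrC yx; case: (j == i); last by rewrite mulr0 normr0.
    by rewrite mulr1 gtr0_norm ?divr_gt0// ltr_pdivrMr// ltr_pMr// ltr1n.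
  exists y; split => //=; split => //.
  have -> : p y = p y - p x by rewrite px0 subr0.
  rewrite pq; last by move=> j ji; apply/eqP; rewrite eq_sym -subr_eq0 yx (negPf ji) mulr0.
  by rewrite yx eqxx mulr1 mulf_neq0 ?q0// gt_eqF// divr_gt0.
pose Z m := [set x : 'rV[R]_l | [/\ p x = 0, 1 <= m%:R * `|q x| &
  forall j, `|x 0 j| <= m%:R]].
(* index 0 is reserved for the complement of V, and m.+1 stands for Z m *)
apply: (@sub_lebesgue_outer_eq0 _ _ _ (\bigcup_m (if m is m.+1 then Z m else ~` V))).
  move=> x /not_andP[nVx|/negP]; first by exists 0%N.
  rewrite negbK => /eqP px0.
  have [Vx|nVx] := pselect (V x); last by exists 0%N.
  have qx : 0 < `|q x| by rewrite normr_gt0 q0.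
  pose B := `|q x|^-1 + \sum_i `|x 0 i|.
  have S0 : 0 <= \sum_i `|x 0 i| by rewrite sumr_ge0.
  have B0 : 0 <= B by rewrite addr_ge0// invr_ge0.
  have Bm := ltW (truncnS_gt B).
  exists (Num.trunc B).+2 => //; split => //.
    rewrite -ler_pdivrMr// div1r (le_trans _ Bm)//.
    by rewrite lerDl.
  move=> j; rewrite (le_trans _ Bm)// (le_trans _ (_ : \sum_i `|x 0 i| <= B))//.
    by rewrite (bigD1 j)//= lerDl sumr_ge0.
  by rewrite lerDr invr_ge0.
apply: lebesgue_outer_bigcup => // -[//|m].
have [L L0 pL] := pl m%:R.
apply: (@lebesgue_outer_lipschitz_graph _ _ _ i m%:R (m%:R * L)).
- exact: mulr_ge0.
- by move=> x [].
- move=> d y z d0 [py qy yM] [pz qz zM] yz.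
  pose z' := \row_j (if j == i then y 0 i else z 0 j) : 'rV[R]_l.
  have z'M j : `|z' 0 j| <= m%:R by rewrite mxE; case: ifP.
  have pz' : p z' = q z * (y 0 i - z 0 i).
    rewrite -[LHS]subr0 -pz pq; first by rewrite mxE eqxx.
    by move=> j /negPf ji; rewrite mxE ji.
  have [_ /(_ d d0)] := pL _ _ z'M yM.
  rewrite py subr0 pz' normrM => H.
  have {}H : `|q z| * `|y 0 i - z 0 i| <= L * d.
    apply: H => j; rewrite mxE; case: ifPn => [/eqP ->|]; first by rewrite subrr normr0.
    by rewrite distrC; exact: yz.
  apply: (@le_trans _ _ (m%:R * `|q z| * `|y 0 i - z 0 i|)).
    by rewrite ler_peMl.
  by rewrite -!mulrA ler_wpM2l.
Qed.

(** * Integration against the completed Lebesgue measure *)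

Section completed_lebesgue.
Variable R : realType.
Local Notation mu := (@completed_lebesgue_measure R).
Local Notation cR := (lebesgueTypeR R).
Local Notation bR := (measurableTypeR R).

Lemma measurable_completed (A : set R) :
  measurable (A : set bR) -> measurable (A : set cR).
Proof. by move=> mA; apply: sub_caratheodory. Qed.

Lemma measurable_fun_completed d (T : measurableType d) (D : set R) (f : R -> T) :
  measurable (D : set bR) ->
  measurable_fun (D : set bR) (f : bR -> T) ->
  measurable_fun (D : set cR) (f : cR -> T).
Proof. by move=> mD mf _ Y mY; apply: measurable_completed; exact: mf. Qed.

(** The identity from the completed to the Borel sigma-algebra is measurable and
pushes the completed measure to the Borel one, so this is a change of variables. *)
Lemma ge0_integral_completed (D : set R) (f : R -> \bar R) :
  measurable (D : set bR) ->
  measurable_fun (D : set bR) (f : bR -> \bar R) ->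
  (forall x, 0 <= f x)%E ->
  (\int[mu]_(x in D) f x = \int[lebesgue_measure]_(x in D) f x)%E.
Proof.
move=> mD mf f0.
have mid : measurable_fun [set: cR] (id : cR -> bR).
  by move=> _ Y mY; rewrite setTI; exact: measurable_completed.
by rewrite -[LHS](@ge0_integral_pushforward _ _ cR bR R id mid mu D f mD mf).
Qed.

Lemma integrable_completed (D : set R) (f : R -> R) :
  measurable (D : set bR) ->
  lebesgue_measure.-integrable (D : set bR) (fun x : bR => (f x)%:E) ->
  mu.-integrable (D : set cR) (fun x : cR => (f x)%:E) /\
  \int[mu]_(x in D) f x = \int[lebesgue_measure]_(x in D) f x.
Proof.
move=> mD /integrableP[mf fi]; split.
  apply/integrableP; split; first exact: measurable_fun_completed.
  rewrite (@ge0_integral_completed D (fun x => `|(f x)%:E|%E))//.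
  by apply: measurableT_comp.
rewrite /Rintegral; congr fine; rewrite integralE [RHS]integralE.
rewrite !ge0_integral_completed//.
  exact: measurable_funeneg.
exact: measurable_funepos.
Qed.

Lemma completed_lebesgue_itv (i : interval R) :
  mu [set` i] = lebesgue_measure [set` i].
Proof. by []. Qed.

Lemma measurable_completed_itv (i : interval R) :
  measurable ([set` i] : set cR).
Proof. by apply: measurable_completed; exact: measurable_itv. Qed.

Lemma completed_lebesgue_set1 (r : R) : mu [set r] = 0%E.
Proof. exact: (@lebesgue_measure_set1 R r). Qed.

Lemma Rintegral_completed_set1 (f : R -> R) (r : R) :
  \int[mu]_(x in [set r]) f x = 0.
Proof.
have m1 : measurable ([set r] : set cR).
  by rewrite -set_itv1; exact: measurable_completed_itv.
rewrite /Rintegral null_set_integral//; first exact: measurable_fun_set1.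
exact: completed_lebesgue_set1.
Qed.

Lemma Rintegral_completed_split (f : R -> R) (a b c : R) (h : bool) :
  a <= b -> b <= c ->
  mu.-integrable (`[a, c] : set cR) (fun x : cR => (f x)%:E) ->
  \int[mu]_(x in `[a, c]) f x =
  \int[mu]_(x in [set` Interval (BLeft a) (BSide h b)]) f x +
  \int[mu]_(x in [set` Interval (BSide h b) (BRight c)]) f x.
Proof.
move=> ab bc fi.
have E : (`[a, c] = [set` Interval (BLeft a) (BSide h b)] `|`
    [set` Interval (BSide h b) (BRight c)])%classic.
  by apply: itv_bndbnd_setU; rewrite bnd_simp//; case: h; rewrite bnd_simp.
rewrite E Rintegral_setU//.
- exact: measurable_completed_itv.
- exact: measurable_completed_itv.
- by rewrite -E.
- apply/disj_setPS => y [/=]; rewrite 2!in_itv/= => /andP[_ yx] /andP[].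
  by case: h yx {E} => /= yx; [rewrite leNgt yx|rewrite ltNge yx].
Qed.

Lemma Rintegral_completed_bndo (f : R -> R) (a : itv_bound R) (t : R) :
  mu.-integrable ([set` Interval a (BRight t)] : set cR) (fun x : cR => (f x)%:E) ->
  \int[mu]_(x in [set` Interval a (BRight t)]) f x =
  \int[mu]_(x in [set` Interval a (BLeft t)]) f x.
Proof.
move=> fi; have [at_|ta] := leP a (BLeft t); last first.
  rewrite !set_itv_ge// -leNgt//; first exact: ltW.
rewrite /Rintegral; congr fine.
have m1 : measurable ([set t] : set cR).
  by rewrite -set_itv1; exact: measurable_completed_itv.
have := negligible_integral m1 (measurable_completed_itv _) fi (completed_lebesgue_set1 t).
by rewrite setDitv1r.
Qed.

(** The bound is only asked on the open interval, so that the value of the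
integrand at a switching time of the input does not matter. *)
Lemma increment_le (f : R -> R) (T s t B : R) :
  mu.-integrable (`[0, T] : set cR) (fun x : cR => (f x)%:E) ->
  0 <= s -> s <= t -> t <= T ->
  (forall r, s < r < t -> `|f r| <= B) ->
  `|\int[mu]_(x in `[0, t]) f x - \int[mu]_(x in `[0, s]) f x| <= B * (t - s).
Proof.
move=> fi s0 st tT fB.
have fi0 : mu.-integrable (`[0, t] : set cR) (fun x : cR => (f x)%:E).
  apply: integrableS fi; [exact: measurable_completed_itv..|].
  by apply: subset_itvl; rewrite bnd_simp.
rewrite (@Rintegral_completed_split f 0 s t false)// addrC addKr.
have fi1 : mu.-integrable (`]s, t] : set cR) (fun x : cR => (f x)%:E).
  apply: integrableS fi0; [exact: measurable_completed_itv..|].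
  by apply: subset_itvr; rewrite bnd_simp.
rewrite Rintegral_completed_bndo//.
have mst := measurable_completed_itv `]s, t[.
have fi2 : mu.-integrable (`]s, t[ : set cR) (fun x : cR => (f x)%:E).
  apply: integrableS fi1; [exact: measurable_completed_itv..|].
  by apply: subset_itvl; rewrite bnd_simp.
have must : mu `]s, t[%classic = (t - s)%:E.
  rewrite completed_lebesgue_itv lebesgue_measure_itv/= lte_fin.
  by case: ltgtP st => // -> _; rewrite subrr.
apply: (le_trans (le_normr_Rintegral mst fi2)).
apply: (@le_trans _ _ (\int[mu]_(x in `]s, t[) B)).
  apply: le_Rintegral => //.
  - exact: integrable_norm fi2.
  - apply/integrableP; split; first exact: measurable_cst.
    have -> := integral_cst mu mst `|B%:E|%E.
    by rewrite -[X in (_ * X)%E]/(mu `]s, t[%classic) must -EFinM ltry.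
by rewrite Rintegral_cst// -[X in fine X]/(mu `]s, t[%classic) must.
Qed.

Lemma FTC2_completed (G g : R -> R) (a b : R) : a <= b ->
  continuous g -> (forall t : R, is_derive t 1 G (g t)) ->
  mu.-integrable (`[a, b] : set cR) (fun x : cR => (g x)%:E) /\
  \int[mu]_(x in `[a, b]) g x = G b - G a.
Proof.
move=> ab cg Gg.
have ig : lebesgue_measure.-integrable `[a, b] (EFin \o g).
  apply: continuous_compact_integrable; first exact: segment_compact.
  exact: continuous_subspaceT.
have [? ->] := integrable_completed (measurable_itv _) ig; split=> //.
have cG : continuous G.
  by move=> t; apply: differentiable_continuous; apply/derivable1_diffP.
move: ab; rewrite le_eqVlt => /predU1P[->|ab].
  by rewrite set_itv1 Rintegral_set1 subrr.
rewrite /Rintegral (@continuous_FTC2 _ g G)//.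
- exact: continuous_subspaceT.
- split; first by move=> x _; case: (Gg x).
    by apply: cvg_at_right_filter; exact: cG.
  by apply: cvg_at_left_filter; exact: cG.
- by move=> x _; rewrite derive1E; exact: derive_val.
Qed.
End completed_lebesgue.

(** * Uniqueness for linear differential equations in integral form *)

Section primitive.
Variable R : realType.
Local Notation mu := (@completed_lebesgue_measure R).
Local Notation cR := (lebesgueTypeR R).

Definition primitive (T : R) (f x : R -> R) : Prop :=
  mu.-integrable (`[0, T] : set cR) (fun t : cR => (f t)%:E) /\
  forall t, 0 <= t <= T -> x t = \int[mu]_(r in `[0, t]) f r.

Lemma integrable_itvS (f : R -> R) (t T : R) : t <= T ->
  mu.-integrable (`[0, T] : set cR) (fun x : cR => (f x)%:E) ->
  mu.-integrable (`[0, t] : set cR) (fun x : cR => (f x)%:E).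
Proof.
move=> tT; apply: integrableS; [exact: measurable_completed_itv..|].
by apply: subset_itvl; rewrite bnd_simp.
Qed.

Lemma primitive_le (T S : R) f x : S <= T -> primitive T f x -> primitive S f x.
Proof.
move=> ST [fi xf]; split; first exact: integrable_itvS fi.
by move=> t /andP[t0 tS]; rewrite xf// t0 (le_trans tS).
Qed.

Lemma primitive0 T : primitive T (fun=> 0) (fun=> 0).
Proof.
split; first exact: integrable0.
by move=> t _; rewrite Rintegral_cst ?mul0r//; exact: measurable_completed_itv.
Qed.

Lemma primitiveD T f g x y :
  primitive T f x -> primitive T g y ->
  primitive T (fun t => f t + g t) (fun t => x t + y t).
Proof.
move=> [fi xf] [gi yg]; split.
  by apply: (integrableD (measurable_completed_itv _) fi gi).
move=> t t0T; rewrite xf// yg// RintegralD//.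
- exact: measurable_completed_itv.
- by case/andP: t0T => _ tT; exact: integrable_itvS fi.
- by case/andP: t0T => _ tT; exact: integrable_itvS gi.
Qed.

Lemma primitiveZ T a f x :
  primitive T f x -> primitive T (fun t => a * f t) (fun t => a * x t).
Proof.
move=> [fi xf]; split.
  by apply: (integrableZl (measurable_completed_itv _) _ fi).
move=> t t0T; rewrite xf// RintegralZl//.
- exact: measurable_completed_itv.
- by case/andP: t0T => _ tT; exact: integrable_itvS fi.
Qed.

Lemma primitive_sum T (I : finType) (f x : I -> R -> R) :
  (forall i, primitive T (f i) (x i)) ->
  primitive T (fun t => \sum_i f i t) (fun t => \sum_i x i t).
Proof.
move=> fx; rewrite unlock /=; elim: index_enum => [|i r IH] /=.
  exact: primitive0.
exact: primitiveD.
Qed.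

Lemma primitive_bounded T f x : primitive T f x ->
  exists2 B, 0 <= B & forall t, 0 <= t <= T -> `|x t| <= B.
Proof.
move=> [fi xf].
have ni : mu.-integrable (`[0, T] : set cR) (fun t : cR => `|f t|%:E).
  exact: integrable_norm fi.
exists (\int[mu]_(r in `[0, T]) `|f r|); first exact: Rintegral_ge0.
move=> t /andP[t0 tT]; rewrite xf ?t0//.
apply: (le_trans (le_normr_Rintegral (measurable_completed_itv _) (integrable_itvS tT fi))).
by rewrite (Rintegral_completed_split false t0 tT ni)/= lerDl Rintegral_ge0.
Qed.

Lemma primitive_increment T f x (s t B : R) : primitive T f x ->
  0 <= s -> s <= t -> t <= T -> (forall r, s < r < t -> `|f r| <= B) ->
  `|x t - x s| <= B * (t - s).
Proof.
move=> [fi xf] s0 st tT fB.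
by rewrite !xf ?s0 ?(le_trans st)// ?(le_trans s0)//; exact: increment_le fi _ _ _ _.
Qed.

(** Archimedean form of the convergence of B / 2^k to zero. *)
Lemma eq0_of_halving (x B : R) : (forall k, `|x| <= B / (2 ^ k)%:R) -> x = 0.
Proof.
move=> xB; apply/eqP; apply: contraT; rewrite -normr_gt0 => x0.
pose k := (Num.trunc (B / `|x|)).+1.
have := truncnS_gt (B / `|x|); rewrite -/k ltr_pdivrMr// => Bk.
have := xB k; rewrite ler_pdivlMr ?ltr0n ?expn_gt0// leNgt mulrC.
rewrite (lt_trans Bk)// ltr_pM2r// ltr_nat; exact: ltn_expl.
Qed.

(** Choose h with L h <= 1/2, where L bounds the norm of M.  On an interval of
length h starting at a zero of z, the integral equation turns a bound B on z into
the bound L h B <= B / 2, hence z = 0 there; finitely many such steps cover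
[a, b].  The equation is only required on the open interval. *)
Lemma primitive_linear_eq0 n (M : 'M[R]_n) (z zd : R -> 'cV[R]_n) (T a b : R) :
  0 <= a -> b <= T ->
  (forall i, primitive T (fun t => zd t i 0) (fun t => z t i 0)) ->
  (forall r, a < r < b -> zd r = M *m z r) ->
  z a = 0 ->
  forall t, a <= t <= b -> z t = 0.
Proof.
move=> a0 bT zP zdE za0.
have /choice[B BP] i : exists B, 0 <= B /\ forall t, 0 <= t <= T -> `|z t i 0| <= B.
  by have [B ? ?] := primitive_bounded (zP i); exists B.
pose B0 := \sum_i B i.
have zB t i : 0 <= t <= T -> `|z t i 0| <= B0.
  move=> tT; apply: le_trans ((BP i).2 _ tT) _.
  by rewrite /B0 (bigD1 i)//= lerDl sumr_ge0// => j _; case: (BP j).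
pose L := \sum_i \sum_j `|M i j|.
have L0 : 0 <= L by rewrite sumr_ge0// => i _; rewrite sumr_ge0.
have ML (y : 'cV[R]_n) C i : 0 <= C -> (forall j, `|y j 0| <= C) ->
    `|(M *m y) i 0| <= L * C.
  move=> C0 yC; rewrite mxE (le_trans (ler_norm_sum _ _ _))//.
  apply: (@le_trans _ _ ((\sum_j `|M i j|) * C)).
    by rewrite mulr_suml ler_sum// => j _; rewrite normrM ler_wpM2l.
  rewrite ler_wpM2r// /L [leRHS](bigD1 i)//= lerDl sumr_ge0// => j _.
  by rewrite sumr_ge0.
pose h := (2 * (L + 1))^-1.
have h0 : 0 < h by rewrite invr_gt0 mulr_gt0// ltr_wpDl.
have Lh : L * h <= 2^-1.
  by rewrite /h ler_pdivrMr; [lra|rewrite mulr_gt0// ltr_wpDl].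
have step c : a <= c -> z c = 0 -> forall t, c <= t <= b -> t <= c + h -> z t = 0.
  move=> ac zc0.
  suff H k t i : c <= t <= b -> t <= c + h -> `|z t i 0| <= B0 / (2 ^ k)%:R.
    move=> t tcb tch; apply/matrixP => i j; rewrite ord1 mxE.
    by apply: eq0_of_halving => k; exact: H.
  elim: k t i => [|k IH] t i /andP[ct tb] tch.
    by rewrite expn0 divr1 zB// (le_trans (le_trans a0 ac) ct)/= (le_trans tb).
  have Bk0 : 0 <= B0 / (2 ^ k)%:R.
    by rewrite divr_ge0// sumr_ge0// => j _; case: (BP j).
  have := @primitive_increment T _ _ c t (L * (B0 / (2 ^ k)%:R)) (zP i)
    (le_trans a0 ac) ct (le_trans tb bT).
  rewrite zc0 [X in _ - X]mxE subr0 => H.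
  apply: (le_trans (H _)).
    move=> r /andP[cr rt]; rewrite zdE; last first.
      by rewrite (le_lt_trans ac)//= (lt_le_trans rt).
    apply: ML => // j; apply: IH.
      by rewrite (ltW cr) (ltW (lt_le_trans rt tb)).
    by rewrite (ltW (lt_le_trans rt tch)).
  have th : t - c <= h by rewrite lerBlDl.
  apply: (@le_trans _ _ (L * (B0 / (2 ^ k)%:R) * h)).
    by rewrite ler_wpM2l// mulr_ge0.
  rewrite mulrAC expnS natrM invfM [leRHS]mulrCA.
  by rewrite ler_wpM2r.
have main (j : nat) t : a <= t <= b -> t <= a + j%:R * h -> z t = 0.
  elim: j t => [|j IH] t /andP[at_ tb].
    rewrite mul0r addr0 => ta.
    by have /eqP <- : a == t by rewrite eq_le at_ ta.
  have [tj _|tj] := leP t (a + j%:R * h); first by apply: IH => //; rewrite at_.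
  move=> tj1.
  have jh : 0 <= j%:R * h by rewrite mulr_ge0// ltW.
  apply: (step (a + j%:R * h)).
  - by rewrite lerDl.
  - by apply: IH; rewrite ?lexx// lerDl jh (ltW (lt_le_trans tj tb)).
  - by rewrite (ltW tj).
  - by move: tj1; rewrite -natr1 mulrDl mul1r addrA.
move=> t tab; apply: (main (Num.trunc ((t - a) / h)).+1) => //.
by rewrite -lerBlDl -ler_pdivrMr// ltW// truncnS_gt.
Qed.

End primitive.

(** * Existence for linear differential equations by power series *)

Section exponential_series.
Variable R : realType.
Implicit Types (e : nat -> R) (t : R).

(** Exponential generating function of e, the form taken by the coordinates of
solutions of linear equations: differentiation becomes the shift of e. *)
Definition exp_series e t : R := limn (pseries (fun k => e k / k`!%:R) t).

(** Geometric growth of e, which makes its exponential generating function entire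
and is inherited by the coefficients of linear equations. *)
Definition exp_growth e := exists C L, [/\ 0 <= C, 0 <= L & forall k, `|e k| <= C * L ^+ k].

Lemma exp_growth_cvg e t : exp_growth e -> cvgn (pseries (fun k => e k / k`!%:R) t).
Proof.
move=> [C [L [C0 L0 eCL]]]; apply: normed_cvg.
apply: (@series_le_cvg _ _ (C *: exp_coeff (L * `|t|))).
- by move=> k; exact: normr_ge0.
- by move=> k; rewrite /= mulr_ge0// exp_coeff_ge0// mulr_ge0.
- move=> k /=; rewrite !normrM normfV normrX normr_nat.
  rewrite [leRHS](_ : _ = C * L ^+ k / k`!%:R * `|t| ^+ k); last first.
    by rewrite -[LHS]/(C * ((L * `|t|) ^+ k / k`!%:R)) exprMn; ring.
  by rewrite ler_wpM2r ?exprn_ge0// ler_wpM2r// invr_ge0.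
- by apply: is_cvg_seriesZ; exact: is_cvg_series_exp_coeff.
Qed.

Lemma exp_growth_shift e : exp_growth e -> exp_growth (fun k => e k.+1).
Proof.
move=> [C [L [C0 L0 eCL]]]; exists (C * L), L; split=> //; first exact: mulr_ge0.
by move=> k; rewrite -mulrA -exprS.
Qed.

Lemma exp_series_derive e t : exp_growth e ->
  is_derive t 1 (exp_series e) (exp_series (fun k => e k.+1) t).
Proof.
move=> eg.
have dE f : pseries_diffs (fun k => f k / k`!%:R) = (fun k => f k.+1 / k`!%:R) :> (nat -> R).
  apply/funext => k; rewrite /pseries_diffs factS natrM invfM.
  by rewrite mulrCA mulrA mulrA mulfK.
have := @pseries_snd_diffs R (fun k => e k / k`!%:R) (`|t| + 1) t.
rewrite !dE; apply.
- exact: exp_growth_cvg.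
- exact: (exp_growth_cvg (exp_growth_shift eg)).
- exact: (exp_growth_cvg (exp_growth_shift (exp_growth_shift eg))).
- by rewrite [ltRHS]ger0_norm ?ltrDl// addr_ge0.
Qed.

Lemma lim_series_head (u : nat -> R) :
  (forall k, u k.+1 = 0) -> limn (series u) = u 0%N.
Proof.
move=> u0; apply/cvg_lim => //; apply: cvg_near_cst; near=> n.
have n0 : (0 < n)%N by near: n; exists 1%N.
rewrite /series/= -(prednK n0) big_nat_recl//= big1 ?addr0//.
Unshelve. all: by end_near. Qed.

Lemma exp_series0 e : exp_series e 0 = e 0%N.
Proof.
rewrite /exp_series /pseries lim_series_head; first by rewrite /= fact0 divr1 expr0 mulr1.
by move=> k /=; rewrite expr0n mulr0.
Qed.

Lemma exp_series_delta (a : R) t : exp_series (fun k => if k is 0 then a else 0) t = a.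
Proof.
rewrite /exp_series /pseries lim_series_head; first by rewrite /= fact0 divr1 expr0 mulr1.
by move=> k /=; rewrite !mul0r.
Qed.

Lemma exp_seriesD e f t : exp_growth e -> exp_growth f ->
  exp_series (fun k => e k + f k) t = exp_series e t + exp_series f t.
Proof.
move=> eg fg; rewrite /exp_series -limD; [|exact: exp_growth_cvg..].
congr (limn _); apply/funext => n; rewrite fctE /pseries /series /= -big_split/=.
by apply: eq_bigr => k _; ring.
Qed.

Lemma exp_seriesZ a e t : exp_growth e ->
  exp_series (fun k => a * e k) t = a * exp_series e t.
Proof.
move=> eg; rewrite /exp_series -[RHS]/(a *: limn _) -limZl_tmp; last exact: exp_growth_cvg.
congr (limn _); apply/funext => n; rewrite fctE /pseries /series /= scaler_sumr.
by apply: eq_bigr => k _; rewrite /GRing.scale/=; ring.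
Qed.

Lemma exp_growth_sum (I : Type) (r : seq I) (a : I -> R) (e : I -> nat -> R) :
  (forall i, exp_growth (e i)) -> exp_growth (fun k => \sum_(i <- r) a i * e i k).
Proof.
move=> eg; elim: r => [|i r [C [L [C0 L0 eCL]]]].
  by exists 0, 0; split=> // k; rewrite big_nil normr0 mul0r.
have [D [K [D0 K0 eDK]]] := eg i.
exists (`|a i| * D + C), (K + L); split.
- by rewrite addr_ge0// mulr_ge0.
- exact: addr_ge0.
- move=> k; rewrite big_cons (le_trans (ler_normD _ _))// mulrDl lerD//.
    rewrite normrM -mulrA ler_wpM2l// (le_trans (eDK k))// ler_wpM2l//.
    by rewrite lerXn2r ?nnegrE ?addr_ge0// lerDl.
  rewrite (le_trans (eCL k))// ler_wpM2l//.
  by rewrite lerXn2r ?nnegrE ?addr_ge0// lerDr.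
Qed.

Lemma exp_series_sum (I : Type) (r : seq I) (a : I -> R) (e : I -> nat -> R) t :
  (forall i, exp_growth (e i)) ->
  exp_series (fun k => \sum_(i <- r) a i * e i k) t =
  \sum_(i <- r) a i * exp_series (e i) t.
Proof.
move=> eg; elim: r => [|i r IH].
  rewrite big_nil -[RHS](exp_series_delta 0 t); congr (exp_series _ t).
  by apply/funext => -[|k]; rewrite big_nil.
rewrite big_cons -IH -exp_seriesZ// -exp_seriesD; last exact: exp_growth_sum.
  by congr (exp_series _ t); apply/funext => k; rewrite big_cons.
have := @exp_growth_sum I [:: i] a e eg.
by congr exp_growth; apply/funext => k; rewrite big_seq1.
Qed.

(** The Taylor coefficients at 0 are forced: d 0 = x0, d 1 = M x0 + p and
d (k+1) = M (d k) for k > 0.  They grow geometrically and shifting them amounts to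
applying M and adding p, so their exponential generating function is a solution. *)
Lemma linear_ode_solution n (M : 'M[R]_n) (p x0 : 'cV[R]_n) :
  exists2 x : R -> 'cV[R]_n, x 0 = x0 &
    forall i (t : R), is_derive t 1 (fun t => x t i 0) ((M *m x t + p) i 0).
Proof.
pose d := fix d k : 'cV[R]_n := if k is k'.+1 then
  M *m d k' + (if k' is 0%N then p else 0) else x0.
pose S := \sum_i \sum_j `|M i j|.
pose C := \sum_i `|x0 i 0| + \sum_i `|p i 0|.
have S0 : 0 <= S by rewrite sumr_ge0// => i _; rewrite sumr_ge0.
have x0C i : `|x0 i 0| <= C.
  by rewrite /C (bigD1 i)//= -addrA lerDl addr_ge0 ?sumr_ge0.
have pC i : `|p i 0| <= C.
  by rewrite /C [X in _ + X](bigD1 i)//= addrCA lerDl addr_ge0 ?sumr_ge0.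
have C0 : 0 <= C by rewrite addr_ge0// sumr_ge0.
have dS k i : `|d k i 0| <= C * (S + 1) ^+ k.
  elim: k i => [|k IH] i; first by rewrite expr0 mulr1.
  have Sk : 0 <= C * (S + 1) ^+ k by rewrite mulr_ge0// exprn_ge0// addr_ge0.
  rewrite mxE (le_trans (ler_normD _ _))// exprSr mulrA mulrDr mulr1 lerD//.
    rewrite mxE (le_trans (ler_norm_sum _ _ _))//.
    apply: (@le_trans _ _ (C * (S + 1) ^+ k * \sum_j `|M i j|)).
      rewrite mulr_sumr ler_sum// => j _.
      by rewrite normrM mulrC ler_wpM2r.
    rewrite ler_wpM2l// /S [leRHS](bigD1 i)//= lerDl sumr_ge0// => j _.
    by rewrite sumr_ge0.
  case: k {IH} Sk => [|k] Sk; last by rewrite mxE normr0.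
  by rewrite expr0 mulr1.
have dg i : exp_growth (fun k => d k i 0).
  by exists C, (S + 1); split=> //; rewrite addr_ge0.
exists (fun t => \col_i exp_series (fun k => d k i 0) t).
  by apply/matrixP => i j; rewrite mxE exp_series0 ord1.
move=> i t.
have -> : (fun t0 => (\col_i0 exp_series (fun k => d k i0 0) t0) i 0) =
    exp_series (fun k => d k i 0) by apply/funext => s; rewrite mxE.
have := exp_series_derive t (dg i).
rewrite (_ : exp_series _ t = (M *m (\col_i0 exp_series (fun k => d k i0 0) t) + p) i 0)//.
transitivity (exp_series (fun k => \sum_j M i j * d k j 0 +
    (if k is 0%N then p i 0 else 0)) t).
  congr (exp_series _ t); apply/funext => k; rewrite [LHS]mxE mxE.
  by case: k => [|k]//=; rewrite mxE.
rewrite exp_seriesD; first last.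
- exists `|p i 0|, 0; split=> // -[|k]; first by rewrite expr0 mulr1.
  by rewrite normr0 expr0n mulr0.
- exact: exp_growth_sum.
rewrite exp_series_sum// exp_series_delta [RHS]mxE mxE; congr (_ + _).
by apply: eq_bigr => j _; rewrite mxE.
Qed.

End exponential_series.

(** * Responses to pulses *)

Section pulses.
Variable R : realType.
Local Notation mu := (@completed_lebesgue_measure R).
Local Notation cR := (lebesgueTypeR R).

(** A one-sided neighbourhood suffices to compute a derivative that is known to
exist.  It is used at the end of a pulse and at time 0, where the outputs are
only compared on the right. *)
Lemma is_derive_eq0_right (f : R -> R) (t d l : R) : 0 < d ->
  is_derive t 1 f l -> (forall s, t <= s -> s < t + d -> f s = 0) -> l = 0.
Proof.
move=> d0 [fd <-] f0.
have : h^-1 *: (f (h *: 1 + t) - f t) @[h --> (0:R)^'+] --> 'D_1 f t.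
  by apply: cvg_dnbhs_at_right; exact: fd.
move=> /cvg_lim <- //; apply/cvg_lim => //; apply: cvg_near_cst; near=> h.
have h0 : 0 < h by [].
have hd : h < d by near: h; exact: nbhs_right_lt.
rewrite !f0 ?subrr ?scaler0// ?ltrDl// /GRing.scale/= mulr1.
  by rewrite lerDr ltW.
by rewrite addrC ltrD2l.
Unshelve. all: by end_near. Qed.

Lemma is_derive_row n (r : 'rV[R]_n) (x : R -> 'cV[R]_n) (v : 'cV[R]_n) (t : R) :
  (forall i, is_derive t 1 (fun t => x t i 0) (v i 0)) ->
  is_derive t 1 (fun t => (r *m x t) 0 0) ((r *m v) 0 0).
Proof.
move=> xd.
rewrite (_ : (fun t => _) = \sum_j (r 0 j \*: (fun t => x t j 0))).
  by rewrite mxE; exact: is_derive_sum.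
by apply/funext => s; rewrite mxE fct_sumE.
Qed.

Lemma is_derive_continuous (x dx : R -> R) :
  (forall t : R, is_derive t 1 x (dx t)) -> continuous x.
Proof.
by move=> xd t; apply: differentiable_continuous; apply/derivable1_diffP; case: (xd t).
Qed.

Lemma linear_ode_solution_at n (M : 'M[R]_n) (p x0 : 'cV[R]_n) (t0 : R) :
  exists2 x : R -> 'cV[R]_n, x t0 = x0 &
    forall i (t : R), is_derive t 1 (fun t => x t i 0) ((M *m x t + p) i 0).
Proof.
have [x xx0 xd] := linear_ode_solution M p x0.
exists (fun t => x (t - t0)); first by rewrite subrr.
move=> i t.
have := @is_derive1_comp R (fun t => x t i 0) (center t0) t _ _
  (xd i (t - t0)) (is_derive_shift t 1 (- t0)).
by rewrite mulr1.
Qed.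

Lemma pulse_input (T t1 a : R) : 0 <= T -> inputs (T, pulse t1 a).
Proof.
move=> T0; split => //=.
  apply: measurable_fun_completed; first exact: measurable_itv.
  rewrite (_ : pulse t1 a = (fun t => a * \1_(`[0, t1[%classic) t)).
    apply: measurable_funTS; apply: measurable_funM => //.
  apply/funext => t; rewrite /pulse indicE mem_setE in_itv/=.
  by case: ifP; rewrite ?mulr1 ?mulr0.
exists `|a|; apply: aeW => t _; rewrite /pulse.
by case: ifP; rewrite ?normr0.
Qed.

Lemma affine_solution_continuous n (M : 'M[R]_n) (p : 'cV[R]_n) (x : R -> 'cV[R]_n) :
  (forall i (t : R), is_derive t 1 (fun t => x t i 0) ((M *m x t + p) i 0)) ->
  forall i, continuous (fun t => (M *m x t + p) i 0).
Proof.
move=> xd i.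
rewrite (_ : (fun t => _) = (fun t => (row i M *m x t) 0 0 + p i 0)); last first.
  by apply/funext => t; rewrite -row_mul !mxE.
move=> t; apply: cvgD; last exact: cvg_cst.
apply: (is_derive_continuous (dx := fun t => (row i M *m (M *m x t + p)) 0 0)) => {}t.
exact: (is_derive_row (row i M) (fun j => xd j t)).
Qed.

Lemma integrable_disjointU d (X : measurableType d)
    (nu : {measure set X -> \bar R}) (A B : set X) (f : X -> \bar R) :
  measurable A -> measurable B -> [disjoint A & B] ->
  nu.-integrable A f -> nu.-integrable B f -> nu.-integrable (A `|` B) f.
Proof.
move=> mA mB AB /integrableP[mfA iA] /integrableP[mfB iB].
have mf : measurable_fun (A `|` B) f by apply/measurable_funU.
apply/integrableP; split=> //.
rewrite ge0_integral_setU//; first exact: lte_add_pinfty.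
exact: measurableT_comp.
Qed.

(** Both phases are solutions on the whole line, so each is the integral of its
derivative, and the two integrals are added at time t1. *)
Lemma pulse_trajectory n (s : bilinear_system R n) (t1 a T : R)
    (x y : R -> 'cV[R]_n) :
  0 <= t1 -> t1 <= T -> x 0 = 0 -> y t1 = x t1 ->
  (forall i (t : R), is_derive t 1 (fun t => x t i 0)
    (((sysA s + a *: sysN s) *m x t + a *: sysb s) i 0)) ->
  (forall i (t : R), is_derive t 1 (fun t => y t i 0) ((sysA s *m y t + 0) i 0)) ->
  trajectory s T (pulse t1 a) (fun t => if t < t1 then x t else y t).
Proof.
move=> t10 t1T x0 yx xd yd i.
pose z t := if t < t1 then x t else y t.
pose f t := rhs s (pulse t1 a) z t i 0.
rewrite -/(primitive T f (fun t => z t i 0)).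
have fx t : 0 <= t < t1 ->
    f t = ((sysA s + a *: sysN s) *m x t + a *: sysb s) i 0.
  by move=> /andP[t0 tt1]; rewrite /f /rhs /pulse /z t0 tt1.
have fy t : t1 <= t -> f t = (sysA s *m y t + 0) i 0.
  move=> t1t; rewrite /f /rhs /pulse /z.
  by rewrite [t < t1]ltNge t1t andbF/= !scale0r !addr0.
have cx := affine_solution_continuous (i := i) xd.
have cy := affine_solution_continuous (i := i) yd.
have ix t : 0 <= t -> t <= t1 ->
    mu.-integrable (`[0, t[ : set cR) (fun t : cR => (f t)%:E) /\
    \int[mu]_(r in `[0, t[) f r = x t i 0.
  move=> t0 tt1; have [gi gI] := FTC2_completed t0 cx (xd i).
  have E r : r \in `[0, t[%classic ->
      ((sysA s + a *: sysN s) *m x r + a *: sysb s) i 0 = f r.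
    rewrite inE /= in_itv/= => /andP[r0 rt].
    by rewrite fx// r0 (lt_le_trans rt).
  have gi' : mu.-integrable (`[0, t[ : set cR)
      (fun r : cR => (((sysA s + a *: sysN s) *m x r + a *: sysb s) i 0)%:E).
    apply: integrableS gi; [exact: measurable_completed_itv..|].
    by apply: subset_itvl; rewrite bnd_simp.
  split.
    apply: eq_integrable gi'; first exact: measurable_completed_itv.
    by move=> r /E ->.
  rewrite -(eq_Rintegral mu E) -Rintegral_completed_bndo//.
  by rewrite gI x0 mxE subr0.
have iy t : t1 <= t ->
    mu.-integrable (`[t1, t] : set cR) (fun t : cR => (f t)%:E) /\
    \int[mu]_(r in `[t1, t]) f r = y t i 0 - x t1 i 0.
  move=> t1t; have [gi gI] := FTC2_completed t1t cy (yd i).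
  have E r : r \in `[t1, t]%classic -> (sysA s *m y r + 0) i 0 = f r.
    by rewrite inE /= in_itv/= => /andP[r0 rt]; rewrite fy.
  split.
    apply: eq_integrable gi; first exact: measurable_completed_itv.
    by move=> r /E ->.
  by rewrite -(eq_Rintegral mu E) gI yx.
have fi : mu.-integrable (`[0, T] : set cR) (fun t : cR => (f t)%:E).
  have -> : (`[0, T] = `[0, t1[ `|` `[t1, T])%classic.
    by apply: itv_bndbnd_setU; rewrite bnd_simp.
  apply: integrable_disjointU; [exact: measurable_completed_itv..| | |].
  - apply/disj_setPS => r [/=]; rewrite 2!in_itv/= => /andP[_ rt1] /andP[].
    by rewrite leNgt rt1.
  - by case: (ix t1).
  - by case: (iy T).
split=> // t /andP[t0 tT].
have fit := integrable_itvS tT fi; rewrite /z.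
have [tt1|t1t] := ltP t t1.
  by rewrite Rintegral_completed_bndo// (ix t t0 (ltW tt1)).2.
rewrite (Rintegral_completed_split true t10 t1t fit) (ix t1 t10 (lexx _)).2.
by rewrite (iy t t1t).2 addrC subrK.
Qed.

Lemma trajectory_comb n (s s' : bilinear_system R n) (T : R) (u : R -> R)
    (x x' : R -> 'cV[R]_n) (P : 'M[R]_n) (i : 'I_n) :
  trajectory s T u x -> trajectory s' T u x' ->
  primitive T (fun t => (rhs s u x t - P *m rhs s' u x' t) i 0)
    (fun t => (x t - P *m x' t) i 0).
Proof.
move=> xt xt'.
have E (y y' : R -> 'cV[R]_n) : (fun t => (y t - P *m y' t) i 0) =
    (fun t => y t i 0 + -1 * \sum_j P i j * y' t j 0).
  by apply/funext => t; rewrite !mxE mulN1r.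
rewrite !E; apply: primitiveD; first exact: xt.
apply: primitiveZ; apply: primitive_sum => j; apply: primitiveZ; exact: xt'.
Qed.

(** During the pulse only the drift A + a N and b matter.  For s = s' this is the
uniqueness of the trajectory; the end point t1 is included although the input
has already switched there. *)
Lemma pulse_trajectory_unique n (s s' : bilinear_system R n) (t1 a : R)
    (x x' : R -> 'cV[R]_n) : 0 <= t1 ->
  sysA s + a *: sysN s = sysA s' + a *: sysN s' -> sysb s = sysb s' ->
  trajectory s t1 (pulse t1 a) x -> trajectory s' t1 (pulse t1 a) x' ->
  forall t, 0 <= t <= t1 -> x t = x' t.
Proof.
move=> t10 EF Eb xt xt'.
have z0 : x 0 - 1%:M *m x' 0 = 0.
  apply/matrixP => i j; rewrite ord1 mul1mx !mxE (xt i).2 ?lexx// (xt' i).2 ?lexx//.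
  by rewrite !set_itv1 !Rintegral_completed_set1 subrr.
move=> t t0; apply/eqP; rewrite -subr_eq0 -[x' t]mul1mx; apply/eqP.
apply: (primitive_linear_eq0 (M := sysA s + a *: sysN s) (lexx 0) (lexx t1)
  (fun i => trajectory_comb 1%:M i xt xt') _ z0) => // r /andP[r0 rt].
rewrite !mul1mx /rhs /pulse (ltW r0) rt/= -EF -Eb mulmxBr.
by rewrite opprD addrACA subrr addr0.
Qed.

(** After the pulse, x - P x' solves z' = A z because P intertwines the two drifts,
and it starts from zero. *)
Lemma pulse_trajectory_after n (s s' : bilinear_system R n) (t1 a T : R)
    (x x' : R -> 'cV[R]_n) (P : 'M[R]_n) : 0 <= t1 -> t1 <= T ->
  P *m sysA s' = sysA s *m P -> x t1 = P *m x' t1 ->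
  trajectory s T (pulse t1 a) x -> trajectory s' T (pulse t1 a) x' ->
  forall t, t1 <= t <= T -> x t = P *m x' t.
Proof.
move=> t10 t1T PA xP xt xt' t t1t; apply/eqP; rewrite -subr_eq0; apply/eqP.
apply: (primitive_linear_eq0 (M := sysA s) t10 (lexx T)
  (fun i => trajectory_comb P i xt xt') _ _ t1t).
  move=> r /andP[r0 rt]; rewrite /rhs /pulse [r < t1]ltNge (ltW r0) andbF.
  by rewrite !scale0r !addr0 mulmxBr !mulmxA PA.
by rewrite xP subrr.
Qed.

Lemma trajectory_le n (s : bilinear_system R n) (T S : R) (u : R -> R) x :
  S <= T -> trajectory s T u x -> trajectory s S u x.
Proof. by move=> ST xt i; exact: primitive_le ST (xt i). Qed.

(** A pulse of duration t leads both systems to the same state x t.  The right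
derivatives at time t of the two outputs are c A x(t) and c A' x(t). *)
Lemma io_equiv_pulse_moment n (s s' : bilinear_system R n) (a : R) (x : R -> 'cV[R]_n) :
  sysA s + a *: sysN s = sysA s' + a *: sysN s' ->
  sysb s = sysb s' -> sysc s = sysc s' ->
  io_equiv s s' -> x 0 = 0 ->
  (forall i (t : R), is_derive t 1 (fun t => x t i 0)
    (((sysA s + a *: sysN s) *m x t + a *: sysb s) i 0)) ->
  forall t, 0 <= t -> ((sysc s *m sysA s - sysc s *m sysA s') *m x t) 0 0 = 0.
Proof.
move=> EF Eb Ec eq_ss x0 xd t1 t10.
have [y yx yd] := linear_ode_solution_at (sysA s) 0 (x t1) t1.
have [y' yx' yd'] := linear_ode_solution_at (sysA s') 0 (x t1) t1.
have T0 : 0 <= t1 + 1 by rewrite addr_ge0.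
have t1T : t1 <= t1 + 1 by rewrite lerDl.
have xt := pulse_trajectory t10 t1T x0 yx xd yd.
have xd' := xd; rewrite EF Eb in xd'.
have xt' := pulse_trajectory t10 t1T x0 yx' xd' yd'.
have H := eq_ss _ _ (pulse_input t1 a T0) _ _ xt xt'.
have d1 := is_derive_row (sysc s) (fun i => yd i t1).
have d2 := is_derive_row (sysc s) (fun i => yd' i t1).
have d3 := is_deriveB d1 d2.
have yy' r : t1 <= r -> r < t1 + 1 ->
    ((fun r => (sysc s *m y r) 0 0) - (fun r => (sysc s *m y' r) 0 0)) r = 0.
  move=> t1r rt; rewrite fctE.
  have := H r; rewrite (le_trans t10)// (ltW rt) => /(_ isT).
  by rewrite /output ltNge t1r/= -Ec => ->; rewrite subrr.
have d0 := is_derive_eq0_right ltr01 d3 yy'.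
rewrite yx yx' !addr0 !mulmxA in d0.
by rewrite mulmxBl -[RHS]d0 [LHS]mxE; congr (_ + _); rewrite mxE.
Qed.

(** The derivative of r x is r F x + r p; evaluating at 0 gives r p = 0, hence
r F x = 0 for all t >= 0, and the same argument applies to r F. *)
Lemma row_annihilates n (F : 'M[R]_n) (p : 'cV[R]_n) (x : R -> 'cV[R]_n) (r : 'rV[R]_n) :
  x 0 = 0 ->
  (forall i (t : R), is_derive t 1 (fun t => x t i 0) ((F *m x t + p) i 0)) ->
  (forall t, 0 <= t -> (r *m x t) 0 0 = 0) ->
  r *m p = 0 /\ r *m F *m p = 0.
Proof.
move=> x0 xd rx.
have D (q : 'rV[R]_n) : (forall t, 0 <= t -> (q *m x t) 0 0 = 0) ->
    forall t, 0 <= t -> (q *m (F *m x t + p)) 0 0 = 0.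
  move=> qx t t0; apply: (is_derive_eq0_right ltr01 (is_derive_row q (fun i => xd i t))).
  by move=> u tu _; rewrite qx// (le_trans t0).
have mx11 (m : 'M[R]_1) : m 0 0 = 0 -> m = 0.
  by move=> m0; apply/matrixP => i j; rewrite !ord1 m0 mxE.
have rp : r *m p = 0.
  by apply: mx11; have := D r rx 0 (lexx 0); rewrite x0 mulmx0 add0r.
have rFx t : 0 <= t -> (r *m F *m x t) 0 0 = 0.
  by move=> t0; have := D r rx t t0; rewrite mulmxDr rp addr0 mulmxA.
split=> //; apply: mx11.
by have := D _ rFx 0 (lexx 0); rewrite x0 mulmx0 add0r.
Qed.

End pulses.

(** * The generic set of systems *)

Section coordinates.
Variables (R : realType) (n : nat).
Local Notation l := (n * n + n * n + (n + n))%N.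
Implicit Types (v x y : 'rV[R]_l).

Definition vec_system v : bilinear_system R n :=
  BilinearSystem (vec_mx (lsubmx (lsubmx v))) (vec_mx (rsubmx (lsubmx v)))
    (lsubmx (rsubmx v))^T (rsubmx (rsubmx v)).

Lemma system_vecK : cancel (@system_vec R n) vec_system.
Proof.
by case=> A N b c; rewrite /vec_system /system_vec/= !(row_mxKl, row_mxKr) !mxvecK trmxK.
Qed.

Lemma vec_systemK : cancel vec_system (@system_vec R n).
Proof. by move=> v; rewrite /system_vec/= !vec_mxK trmxK !hsubmxK. Qed.

Definition idxA (i j : 'I_n) : 'I_l := lshift _ (lshift _ (mxvec_index i j)).
Definition idxN (i j : 'I_n) : 'I_l := lshift _ (rshift _ (mxvec_index i j)).
Definition idxb (i : 'I_n) : 'I_l := rshift _ (lshift _ i).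
Definition idxc (j : 'I_n) : 'I_l := rshift _ (rshift _ j).

Lemma coordA v i j : sysA (vec_system v) i j = v 0 (idxA i j).
Proof. by rewrite !mxE. Qed.
Lemma coordN v i j : sysN (vec_system v) i j = v 0 (idxN i j).
Proof. by rewrite !mxE. Qed.
Lemma coordb v i : sysb (vec_system v) i 0 = v 0 (idxb i).
Proof. by rewrite !mxE. Qed.
Lemma coordc v j : sysc (vec_system v) 0 j = v 0 (idxc j).
Proof. by rewrite !mxE. Qed.

Lemma mxvec_index_eq (i j a b : 'I_n) :
  (mxvec_index i j == mxvec_index a b) = ((i, j) == (a, b)).
Proof. by rewrite /mxvec_index (inj_eq (@cast_ord_inj _ _ _)) (inj_eq enum_rank_inj). Qed.

Lemma vec_system_updateA x y a b :
  (forall k, k != idxA a b -> x 0 k = y 0 k) ->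
  [/\ sysA (vec_system y) =
        sysA (vec_system x) + (y 0 (idxA a b) - x 0 (idxA a b)) *: delta_mx a b,
      sysN (vec_system y) = sysN (vec_system x),
      sysb (vec_system y) = sysb (vec_system x) &
      sysc (vec_system y) = sysc (vec_system x)].
Proof.
move=> xy; split; apply/matrixP => i j.
- have E (d : R) (M : 'M[R]_n) : (M + d *: delta_mx a b) i j = M i j + d * ((i, j) == (a, b))%:R.
    by rewrite !mxE.
  rewrite E !coordA; have [[-> ->]|ij] := eqVneq (i, j) (a, b).
    by rewrite mulr1 addrC subrK.
  by rewrite mulr0 addr0 xy// !eq_lshift mxvec_index_eq.
- by rewrite !coordN xy// eq_lshift eq_rlshift.
- by rewrite !ord1 !coordb xy// eq_rlshift.
- by rewrite !ord1 !coordc xy// eq_rlshift.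
Qed.

Lemma vec_system_updateb x y a :
  (forall k, k != idxb a -> x 0 k = y 0 k) ->
  sysb (vec_system y) =
    sysb (vec_system x) + (y 0 (idxb a) - x 0 (idxb a)) *: delta_mx a 0 /\
  sysc (vec_system y) = sysc (vec_system x).
Proof.
move=> xy; split; apply/matrixP => i j; rewrite !ord1.
- have E (d : R) (M : 'cV[R]_n) : (M + d *: delta_mx a 0) i 0 = M i 0 + d * (i == a)%:R.
    by rewrite !mxE eqxx andbT.
  rewrite E !coordb; have [->|ia] := eqVneq i a.
    by rewrite mulr1 addrC subrK.
  by rewrite mulr0 addr0 xy// eq_rshift eq_lshift.
- by rewrite !coordc xy// eq_rshift eq_rlshift.
Qed.

Lemma loc_lipschitz_A i j : loc_lipschitz (fun v => sysA (vec_system v) i j).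
Proof.
by under eq_fun do rewrite coordA; exact: loc_lipschitz_coord.
Qed.
Lemma loc_lipschitz_N i j : loc_lipschitz (fun v => sysN (vec_system v) i j).
Proof.
by under eq_fun do rewrite coordN; exact: loc_lipschitz_coord.
Qed.
Lemma loc_lipschitz_b i : loc_lipschitz (fun v => sysb (vec_system v) i 0).
Proof.
by under eq_fun do rewrite coordb; exact: loc_lipschitz_coord.
Qed.
Lemma loc_lipschitz_c i : loc_lipschitz (fun v => sysc (vec_system v) 0 i).
Proof.
by under eq_fun do rewrite coordc; exact: loc_lipschitz_coord.
Qed.

End coordinates.

Section generic_set.
Variables (R : realType) (n : nat) (i0 i1 : 'I_n) (alpha : R).
Hypothesis i01 : i0 != i1.
Local Notation l := (n * n + n * n + (n + n))%N.

Definition pulse_drift (s : bilinear_system R n) : 'M[R]_n :=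
  sysA s + alpha *: sysN s.

Definition row_minor (r q : 'rV[R]_n) : R := r 0 i0 * q 0 i1 - r 0 i1 * q 0 i0.
Definition col_minor (r q : 'cV[R]_n) : R := r i0 0 * q i1 0 - r i1 0 * q i0 0.

(** The first two conditions provide nonzero leading coefficients for the other
three. *)
Definition nondegenerate (s : bilinear_system R n) : Prop :=
  [/\ sysc s 0 i0 != 0, sysb s i0 0 != 0, (sysc s *m sysb s) 0 0 != 0,
      row_minor (sysc s) (sysc s *m sysA s) != 0 &
      col_minor (sysb s) (pulse_drift s *m sysb s) != 0].

Lemma row_minor_update (r q : 'rV[R]_n) d :
  row_minor r (q + (d * r 0 i0) *: delta_mx 0 i1) = row_minor r q + r 0 i0 ^+ 2 * d.
Proof. by rewrite /row_minor !mxE !eqxx/= (negPf i01)/=; ring. Qed.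

Lemma col_minor_update (r q : 'cV[R]_n) d :
  col_minor r (q + (d * r i0 0) *: delta_mx i1 0) = col_minor r q + r i0 0 ^+ 2 * d.
Proof. by rewrite /col_minor !mxE !eqxx/= (negPf i01)/=; ring. Qed.

Lemma mul_delta_row m (r : 'rV[R]_n) d a (b : 'I_m) :
  r *m (d *: delta_mx a b) = (d * r 0 a) *: delta_mx 0 b :> 'rV[R]_m.
Proof.
rewrite -scalemxAr -scalerA; congr (_ *: _); apply/matrixP => i j; rewrite !ord1 !mxE.
rewrite (bigD1 a)//= big1 ?addr0; first by rewrite !mxE !eqxx.
by move=> k /negPf ka; rewrite mxE ka mulr0.
Qed.

Lemma mul_delta_col m (r : 'cV[R]_n) d (a : 'I_m) b :
  (d *: delta_mx a b) *m r = (d * r b 0) *: delta_mx a 0 :> 'cV[R]_m.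
Proof.
rewrite -scalemxAl -scalerA; congr (_ *: _); apply/matrixP => i j; rewrite !ord1 !mxE.
rewrite (bigD1 b)//= big1 ?addr0; first by rewrite !mxE !eqxx andbT mulrC.
by move=> k /negPf ka; rewrite mxE ka andbF mul0r.
Qed.

Lemma loc_lipschitz_mulmx p q m k (X : 'rV[R]_k -> 'M[R]_(p, q))
    (Y : 'rV[R]_k -> 'M[R]_(q, m)) i j :
  (forall i j, loc_lipschitz (fun v => X v i j)) ->
  (forall i j, loc_lipschitz (fun v => Y v i j)) ->
  loc_lipschitz (fun v => (X v *m Y v) i j).
Proof.
move=> Xl Yl; under eq_fun do rewrite mxE.
by apply: loc_lipschitz_sum => h; exact: loc_lipschitzM.
Qed.

(** The conditions are imposed one after the other.  The polynomial c b is affine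
in b i0 with coefficient c i0; the minor of (c, c A) is affine in A i0 i1 with
coefficient (c i0)^2; the minor of (b, F b) is affine in A i1 i0 with coefficient
(b i0)^2. *)
Lemma generic_nondegenerate : generic_systems nondegenerate.
Proof.
rewrite /generic_systems.
have -> : (@system_vec R n @` nondegenerate) = [set v | nondegenerate (vec_system v)].
  apply/seteqP; split=> [_ [s gs <-]|v gv] /=; first by rewrite system_vecK.
  by exists (vec_system v) => //; rewrite vec_systemK.
have l0 : (0 < l)%N by exact: leq_ltn_trans (leq0n _) (ltn_ord (idxc i0)).
have lc (i : 'I_1) (j : 'I_n) : loc_lipschitz (fun v : 'rV[R]_l => sysc (vec_system v) i j).
  by rewrite ord1; exact: loc_lipschitz_c.
have lb (i : 'I_n) (j : 'I_1) : loc_lipschitz (fun v : 'rV[R]_l => sysb (vec_system v) i j).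
  by rewrite ord1; exact: loc_lipschitz_b.
have lA := @loc_lipschitz_A R n.
have lF (i j : 'I_n) : loc_lipschitz (fun v => pulse_drift (vec_system v) i j).
  have -> : (fun v => pulse_drift (vec_system v) i j) =
      (fun v => sysA (vec_system v) i j + alpha * sysN (vec_system v) i j).
    by apply/funext => v; rewrite !mxE.
  apply: loc_lipschitzD; first exact: lA.
  by apply: loc_lipschitzM; [exact: loc_lipschitz_cst|exact: loc_lipschitz_N].
have g1 : generic [set v : 'rV[R]_l | sysc (vec_system v) 0 i0 != 0].
  have := @generic_affine R l _ (idxc i0) (fun v => sysc (vec_system v) 0 i0) (fun=> 1)
    (genericT R l0) (lc 0 i0).
  rewrite (_ : [set x | _ /\ _] = [set v | sysc (vec_system v) 0 i0 != 0]); last first.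
    by apply/seteqP; split=> [v []|v].
  apply; last by move=> *; exact: oner_neq0.
  by move=> x y xy; rewrite !coordc mul1r.
have g2 : generic [set v : 'rV[R]_l | sysc (vec_system v) 0 i0 != 0 /\
    sysb (vec_system v) i0 0 != 0].
  apply: (generic_affine (i := idxb i0) (q := fun=> 1) g1 (lb i0 0)).
    by move=> x y _; rewrite !coordb mul1r.
  by move=> *; exact: oner_neq0.
have g3 : generic [set v : 'rV[R]_l | (sysc (vec_system v) 0 i0 != 0 /\
    sysb (vec_system v) i0 0 != 0) /\
    (sysc (vec_system v) *m sysb (vec_system v)) 0 0 != 0].
  apply: (generic_affine (i := idxb i0) (q := fun v => sysc (vec_system v) 0 i0)
    g2 (loc_lipschitz_mulmx 0 0 lc lb)); last by move=> x [].
  move=> x y /vec_system_updateb[-> ->].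
  have E (X : 'M[R]_1) d : (X + d *: delta_mx 0 0) 0 0 - X 0 0 = d.
    by rewrite !mxE mulr1 addrC addKr.
  by rewrite mulmxDr mul_delta_row E mulrC.
have g4 : generic [set v : 'rV[R]_l | ((sysc (vec_system v) 0 i0 != 0 /\
    sysb (vec_system v) i0 0 != 0) /\
    (sysc (vec_system v) *m sysb (vec_system v)) 0 0 != 0) /\
    row_minor (sysc (vec_system v)) (sysc (vec_system v) *m sysA (vec_system v)) != 0].
  apply: (generic_affine (i := idxA i0 i1) (q := fun v => sysc (vec_system v) 0 i0 ^+ 2) g3).
  - have lcA := loc_lipschitz_mulmx _ _ lc lA.
    by apply: loc_lipschitzD; [|apply: loc_lipschitzN]; apply: loc_lipschitzM.
  - move=> x y /vec_system_updateA[-> _ _ ->].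
    by rewrite mulmxDr mul_delta_row row_minor_update [LHS]addrC addKr.
  - by move=> x [[? ?] ?]; rewrite expf_neq0.
rewrite (_ : [set v | nondegenerate (vec_system v)] =
    [set v | (((sysc (vec_system v) 0 i0 != 0 /\
    sysb (vec_system v) i0 0 != 0) /\
    (sysc (vec_system v) *m sysb (vec_system v)) 0 0 != 0) /\
    row_minor (sysc (vec_system v)) (sysc (vec_system v) *m sysA (vec_system v)) != 0) /\
    col_minor (sysb (vec_system v))
      (pulse_drift (vec_system v) *m sysb (vec_system v)) != 0]); last first.
  by apply/seteqP; split=> v /=; [case=> *; do !split|move=> [[[[? ?] ?] ?] ?]; split].
apply: (generic_affine (i := idxA i1 i0) (q := fun v => sysb (vec_system v) i0 0 ^+ 2) g4).
- have lFb := loc_lipschitz_mulmx _ _ lF lb.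
  by apply: loc_lipschitzD; [|apply: loc_lipschitzN]; apply: loc_lipschitzM.
- move=> x y /vec_system_updateA; rewrite /pulse_drift => -[-> -> -> _].
  by rewrite [_ + _ + alpha *: _]addrAC mulmxDl mul_delta_col col_minor_update [LHS]addrC addKr.
- by move=> x [[[? ?] ?] ?]; rewrite expf_neq0.
Qed.
End generic_set.

(** * The companion system *)

(** In the plane, (- x1, x0) is orthogonal to (x0, x1), and (1, 0) is when x0 = 0.
If the second condition fails, doubling the vector repairs it,
because 1 + 2 (-1) = -1. *)
Lemma exists_covector (R : realType) (x0 x1 v0 v1 : R) :
  exists p q : R, [/\ p * x0 + q * x1 = 0, 1 + (p * v0 + q * v1) != 0 &
    (p != 0) || (q != 0)].
Proof.
suff [p [q [pqx pq]]] : exists p q : R, p * x0 + q * x1 = 0 /\ (p != 0) || (q != 0).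
  have [pqv|pqv] := eqVneq (1 + (p * v0 + q * v1)) 0; last by exists p, q.
  exists (2 * p), (2 * q); split.
  - by rewrite -!mulrA -mulrDr pqx mulr0.
  - have -> : 1 + (2 * p * v0 + 2 * q * v1) = 2 * (1 + (p * v0 + q * v1)) - 1 by ring.
    by rewrite pqv mulr0 sub0r oppr_eq0 oner_neq0.
  - by rewrite !mulf_eq0 pnatr_eq0/= -negb_and; move: pq; rewrite -negb_and.
have [x00|x00] := eqVneq x0 0.
  exists 1, 0; split; last by rewrite oner_neq0.
  by rewrite x00 mulr0 mul0r addr0.
exists (- x1), x0; split; last by rewrite x00 orbT.
by ring.
Qed.

Section shear.
Variables (R : realType) (n : nat) (i0 i1 : 'I_n) (alpha : R).
Hypothesis i01 : i0 != i1.
Hypothesis alpha0 : alpha != 0.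

(** P = 1 + v w, where v is supported on the coordinates i0, i1 and chosen so that
r v is the minor of (c, r) for every row r; in particular c v = 0.  The row w has the same
support and annihilates x.  By Sherman-Morrison, P is invertible
when 1 + w v <> 0.  A nonzero w with this support cannot annihilate
two columns whose minor is nonzero. *)
Lemma shear_exists (c : 'rV[R]_n) (x : 'cV[R]_n) :
  exists (P Q : 'M[R]_n) (w : 'rV[R]_n),
    [/\ P *m Q = 1%:M /\ Q *m P = 1%:M,
        c *m P = c /\ c *m Q = c,
        P *m x = x,
        (forall r : 'rV[R]_n, r *m P = r + row_minor i0 i1 c r *: w) /\
        1 + row_minor i0 i1 c w != 0 &
        forall b f : 'cV[R]_n, w *m b = 0 -> w *m f = 0 -> col_minor i0 i1 b f = 0].
Proof.
have [p [q [pqx pqv pq]]] := exists_covector (x i0 0) (x i1 0) (- c 0 i1) (c 0 i0).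
pose v : 'cV[R]_n := c 0 i0 *: delta_mx i1 0 - c 0 i1 *: delta_mx i0 0.
pose w : 'rV[R]_n := p *: delta_mx 0 i0 + q *: delta_mx 0 i1.
have wE (y : 'cV[R]_n) : w *m y = (p * y i0 0 + q * y i1 0)%:M.
  rewrite mulmxDl !mul_delta_col; apply/matrixP => i j; rewrite !ord1 !mxE.
  by rewrite !mulr1n !mulr1.
have vE (r : 'rV[R]_n) : r *m v = (row_minor i0 i1 c r)%:M.
  rewrite mulmxBr !mul_delta_row; apply/matrixP => i j; rewrite !ord1 !mxE.
  by rewrite !mulr1n !mulr1.
have cv : c *m v = 0.
  by rewrite vE /row_minor mulrC subrr; apply/matrixP => i j; rewrite !mxE mul0rn.
pose sg := row_minor i0 i1 c w.
have sgE : sg = p * - c 0 i1 + q * c 0 i0.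
  by rewrite /sg /row_minor !mxE !eqxx/= [i1 == i0]eq_sym (negPf i01)/=; ring.
have sg1 : 1 + sg != 0 by rewrite sgE.
pose k := (1 + sg)^-1.
have vwvw : v *m w *m (v *m w) = sg *: (v *m w).
  by rewrite mulmxA -[v *m w *m v]mulmxA vE mul_mx_scalar scalemxAl.
exists (1%:M + v *m w), (1%:M - k *: (v *m w)), w; split.
- have kE : 1 - k - k * sg = 0 by rewrite -addrA -opprD -{1}[k]mulr1 -mulrDr mulVf// subrr.
  split.
    rewrite mulmxDl mul1mx mulmxBr mulmx1 -scalemxAr vwvw scalerA -addrA.
    rewrite -[RHS]addr0; congr (_ + _).
    by rewrite -[RHS](scale0r (v *m w)) -kE !scalerBl scale1r addrA [- _ + _]addrC.
  rewrite mulmxBl mul1mx -[(k *: (v *m w)) *m _]scalemxAl.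
  rewrite [v *m w *m _]mulmxDr mulmx1 vwvw scalerDr scalerA -addrA.
  rewrite -[RHS]addr0; congr (_ + _).
  by rewrite -[RHS](scale0r (v *m w)) -kE !scalerBl scale1r opprD addrA.
- by rewrite mulmxDr mulmxBr mulmx1 -scalemxAr mulmxA cv mul0mx scaler0 addr0 subr0.
- by rewrite mulmxDl mul1mx -mulmxA wE pqx mul_mx_scalar scale0r addr0.
- by split=> // r; rewrite mulmxDr mulmx1 mulmxA vE mul_scalar_mx.
- have E (y : 'cV[R]_n) : w *m y = 0 -> p * y i0 0 + q * y i1 0 = 0.
    by rewrite wE => /matrixP/(_ 0 0); rewrite !mxE mulr1n.
  move=> b f /E bE /E fE; case/orP: pq => pq; apply: (mulfI pq); rewrite mulr0.
    have -> : p * col_minor i0 i1 b f = (p * b i0 0 + q * b i1 0) * f i1 0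
      - (p * f i0 0 + q * f i1 0) * b i1 0 by rewrite /col_minor; ring.
    by rewrite bE fE !mul0r subrr.
  have -> : q * col_minor i0 i1 b f = (p * f i0 0 + q * f i1 0) * b i0 0
    - (p * b i0 0 + q * b i1 0) * f i0 0 by rewrite /col_minor; ring.
  by rewrite bE fE !mul0r subrr.
Qed.

(** The shear must fix the state at the end of the pulse.  That state is taken from
any trajectory under the pulse, all of them being equal by uniqueness. *)
Lemma sheared_system (tau : R) (s : bilinear_system R n) : 0 <= tau ->
  nondegenerate i0 i1 alpha s -> exists s', [/\ nondegenerate i0 i1 alpha s',
    io_equiv_under (pulses tau alpha) s s' & ~ io_equiv s s'].
Proof.
move=> tau0 [gc gb gcb gcA gbF].
have [x xP] : exists x : 'cV[R]_n, forall z, trajectory s tau (pulse tau alpha) z -> z tau = x.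
  (* without any trajectory every x qualifies *)
  have [[z0 z0t]|nz] := pselect (exists z, trajectory s tau (pulse tau alpha) z).
    exists (z0 tau) => z zt.
    by apply: (pulse_trajectory_unique tau0 erefl erefl zt z0t); rewrite tau0 lexx.
  by exists 0 => z zt; exfalso; apply: nz; exists z.
have [P [Q [w [[PQ QP] [cP cQ] Px [rP sg1] wbf]]]] := shear_exists (sysc s) x.
set F := pulse_drift alpha s in gbF.
pose A' := Q *m sysA s *m P.
pose s' := BilinearSystem A' (alpha^-1 *: (F - A')) (sysb s) (sysc s).
have FE : F = sysA s' + alpha *: sysN s'.
  by rewrite /= scalerA mulfV// scale1r addrC subrK.
have cA' : sysc s *m A' =
    sysc s *m sysA s + row_minor i0 i1 (sysc s) (sysc s *m sysA s) *: w.
  by rewrite /A' !mulmxA cQ rP.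
exists s'; split.
- split=> //=.
    rewrite cA' /row_minor.
    move: gcA sg1; rewrite /row_minor; set m := _ - _ => m0 sg1.
    rewrite [X in _ * X - _]mxE [X in _ - _ * X]mxE.
    rewrite [(m *: w) 0 i1]mxE [(m *: w) 0 i0]mxE.
    rewrite (_ : _ - _ = m * (1 + (sysc s 0 i0 * w 0 i1 - sysc s 0 i1 * w 0 i0))).
      by rewrite mulf_neq0.
    by rewrite /m; ring.
  by rewrite -/(pulse_drift alpha s') /pulse_drift -FE.
- move=> T u [/= tauT ->] z z' zt zt' t /andP[t0 tT].
  have tT' := ltW tauT.
  have zz' := pulse_trajectory_unique tau0 FE erefl
    (trajectory_le tT' zt) (trajectory_le tT' zt').
  rewrite /output; have [ttau|taut] := leP t tau; first by rewrite zz' ?t0.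
  rewrite (pulse_trajectory_after (P := P) tau0 tT' _ _ zt zt'); last by rewrite (ltW taut).
  + by rewrite mulmxA cP.
  + by rewrite /= /A' !mulmxA PQ mul1mx.
  + by rewrite -zz' ?tau0 ?lexx// (xP z (trajectory_le tT' zt)) Px.
- move=> eqss.
  have [y y0 yd] := linear_ode_solution F (alpha *: sysb s) 0.
  have rx := io_equiv_pulse_moment FE erefl erefl eqss y0 yd.
  have [r1 r2] := row_annihilates y0 yd rx.
  have rE : sysc s *m sysA s - sysc s *m A' =
      - row_minor i0 i1 (sysc s) (sysc s *m sysA s) *: w.
    by rewrite cA' opprD addrA subrr add0r scaleNr.
  pose k := - row_minor i0 i1 (sysc s) (sysc s *m sysA s) * alpha.
  have nz : k != 0 by rewrite mulf_neq0// oppr_eq0.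
  have kE (X : 'M[R]_1) : k *: X = 0 -> X = 0.
    by move=> /eqP; rewrite scaler_eq0 (negPf nz) => /eqP.
  move: r1 r2; rewrite /= rE -!scalemxAl -!scalemxAr !scalerA -/k => /kE r1 /kE r2.
  by move: gbF; rewrite (wbf _ _ r1) ?eqxx// mulmxA.
Qed.

End shear.

(** For alpha = 0 the pulse is the zero input and all states stay at 0.  The
input 1 on [0, 1) separates the systems: the derivative at 0 of the
output is c b <> 0, and it changes sign with c. *)
Lemma negated_output_system (R : realType) (n : nat) (i0 i1 : 'I_n) (tau : R)
    (s : bilinear_system R n) :
  nondegenerate i0 i1 0 s -> exists s', [/\ nondegenerate i0 i1 0 s',
    io_equiv_under (pulses tau 0) s s' & ~ io_equiv s s'].
Proof.
move=> [gc gb gcb gcA gbF].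
pose s' := BilinearSystem (sysA s) (sysN s) (sysb s) (- sysc s).
exists s'; split.
- split=> //=.
  + by rewrite mxE oppr_eq0.
  + by rewrite mulNmx mxE oppr_eq0.
  + move: gcA; rewrite /row_minor mulNmx.
    by rewrite ![(- _ : 'rV_n) _ _]mxE !mulrNN.
- have z0 T z t : 0 <= t <= T -> trajectory s T (pulse tau 0) z -> z t = 0.
    move=> tT zt.
    apply: (primitive_linear_eq0 (M := sysA s) (lexx 0) (lexx T) zt _ _ tT).
      by move=> r _; rewrite /rhs /pulse if_same !scale0r !addr0.
    apply/matrixP => i j; rewrite !ord1 (zt i).2; last first.
      by case/andP: tT => t0 tT; rewrite lexx (le_trans t0).
    by rewrite set_itv1 Rintegral_completed_set1 mxE.
  move=> T u [/= _ ->] z z' zt zt' t tT.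
  by rewrite /output (z0 _ _ _ tT zt) (z0 _ _ _ tT zt') !mulmx0.
- move=> eqss.
  have [x x0 xd] := linear_ode_solution (sysA s + 1 *: sysN s) (1 *: sysb s) 0.
  have [y y0 yd] := linear_ode_solution_at (sysA s) 0 (x 1) 1.
  have xt := pulse_trajectory (ler01) (lexx 1) x0 y0 xd yd.
  have cx t : 0 <= t -> t < 0 + 1 -> (sysc s *m x t) 0 0 = 0.
    rewrite add0r => t0 t1.
    have := eqss _ _ (pulse_input 1 1 ler01) _ _ xt xt t.
    rewrite t0 (ltW t1) /output t1 /= mulNmx [X in _ = X]mxE => /(_ isT)/eqP.
    by rewrite -addr_eq0 -mulr2n mulrn_eq0/= => /eqP.
  have := is_derive_eq0_right ltr01 (is_derive_row (sysc s) (fun i => xd i 0)) cx.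
  by rewrite x0 mulmx0 add0r scale1r => /eqP; rewrite (negPf gcb).
Qed.

Unset Implicit Arguments.

Theorem theorem1 (R : realType) (n : nat) (hn : (2 <= n)%N)
    (tau alpha : R) (htau : 0 <= tau) :
  exists2 S : set (bilinear_system R n), generic_systems S &
    forall s, S s -> exists s', [/\ S s',
      io_equiv_under (pulses tau alpha) s s' &
      ~ io_equiv s s'].
Proof.
have i01 : Ordinal (ltnW hn) != Ordinal hn by [].
exists (nondegenerate (Ordinal (ltnW hn)) (Ordinal hn) alpha); first exact: generic_nondegenerate.
move=> s gs; have [a0|a0] := eqVneq alpha 0; last exact: sheared_system.
by rewrite a0 in gs *; exact: negated_output_system.
Qed.
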